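(* Let $(\Gamma,K)$ be a finite skew translation generalized quadrangle of order $(t,t)$ with elation point $x$, and let $\mathcal{S}\leq K$ be the group of all symmetries of $\Gamma$ with center $x$. Suppose that $\mathcal{S}$ is cyclic. Then $t = p$ is a prime and $\Gamma$ is isomorphic to the symplectic quadrangle $\mathcal{W}(p)$.
   Context: A thick generalized quadrangle (GQ) is a point-line incidence geometry $\Gamma=(\mathcal{P},\mathcal{L},\mathbf{I})$ such that: (a) $\Gamma$ contains no ordinary digons or triangles; (b) any two elements of $\mathcal{P}\cup\mathcal{L}$ are contained in an ordinary quadrangle; (c) there exists an ordinary pentagon. Then there are constants $s,t \ge 2$ such that each line is incident with $s+1$ points and each point is incident with $t+1$ lines; $(s,t)$ is the order of $\Gamma$ (''order $t$'' means order $(t,t)$). All GQs here are thick and finite. For points $X,Y$, $X\sim Y$ means that some line is incident with both (in particular $X \sim X$); $X^\perp=\{Y : Y\sim X\}$. A symmetry with center a point $x$ is an automorphism of $\Gamma$ fixing every point of $x^\perp$. The point $x$ is a center of symmetry if there are $Y,Z\in x^\perp$ with $Y\not\sim Z$ such that the group of all symmetries with center $x$ acts transitively on $(Y^\perp\cap Z^\perp)\setminus\{x\}$; for a finite GQ of order $(s,t)$ this is equivalent to this group having order $t$. An elation generalized quadrangle (EGQ) $(\Gamma,K)$ with elation point $x$ and elation group $K$ is a thick GQ $\Gamma$ with an automorphism group $K$ that fixes every line incident with $x$ and acts sharply transitively on the points not collinear with $x$. A skew translation generalized quadrangle (STGQ) is an EGQ $(\Gamma,K)$ with elation point $x$ such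 that $x$ is a center of symmetry and the group $\mathcal{S}$ of all symmetries with center $x$ is a subgroup of $K$. For a prime power $q$, the symplectic quadrangle $\mathcal{W}(q)$ is the GQ of order $(q,q)$ whose points are the points of the projective space $\mathbb{P}^3(\mathbb{F}_q)$ and whose lines are the absolute (totally isotropic) lines with respect to a symplectic polarity of $\mathbb{P}^3(\mathbb{F}_q)$, with the natural incidence. *)

(* Defs.v *)
From HB Require Import structures.
From mathcomp Require Import all_boot all_order all_fingroup all_algebra.
From mathcomp Require Import all_solvable.

Set Implicit Arguments.
Unset Strict Implicit.
Unset Printing Implicit Defensive.

Import GroupScope GRing.Theory.

Record geometry := Geometry {
  point : finType;
  line : finType;
  inc : point -> line -> bool
}.

Definition isomorphic (G H : geometry) : Prop :=
  exists (f : point G -> point H) (h : line G -> line H),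
    [/\ bijective f, bijective h
      & forall y l, inc (f y) (h l) = inc y l].

(* The ambient group of pairs consisting of a permutation of the points and a
   permutation of the lines. *)
Notation permT G := ({perm point G} * {perm line G})%type.

Section Geometry.

Variable G : geometry.

(* An ordinary n-gon is a closed circuit
     p 0, l 0, p 1, l 1, ..., p (n - 1), l (n - 1), p 0
   of n distinct points and n distinct lines, consecutive elements being
   incident; [ordS] is the successor modulo n. *)
Definition ordinary_gon n (p : 'I_n -> point G) (l : 'I_n -> line G) : Prop :=
  [/\ injective p, injective l
    & forall i, inc (p i) (l i) /\ inc (p (ordS i)) (l i)].

Definition gon_contains n (p : 'I_n -> point G) (l : 'I_n -> line G)
    (u : point G + line G) : Prop :=
  match u with
  | inl y => exists i, p i = y
  | inr m => exists i, l i = m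
  end.

Definition has_gon n : Prop :=
  exists (p : 'I_n -> point G) (l : 'I_n -> line G), ordinary_gon p l.

Definition thick_GQ : Prop :=
  [/\ ~ has_gon 2 /\ ~ has_gon 3,
      forall u v : point G + line G,
        exists (p : 'I_4 -> point G) (l : 'I_4 -> line G),
          [/\ ordinary_gon p l, gon_contains p l u & gon_contains p l v]
    & has_gon 5].

Definition has_order (s t : nat) : Prop :=
  (forall l : line G, #|[set y | inc y l]| = s.+1) /\
  (forall y : point G, #|[set l | inc y l]| = t.+1).

Definition collinear (y z : point G) : bool :=
  [exists l, inc y l && inc z l].

Definition perp (y : point G) : {set point G} := [set z | collinear z y].

Definition automorphisms : {set permT G} :=
  [set g : permT G | [forall y, forall l, inc (g.1 y) (g.2 l) == inc y l]].

Lemma automorphisms_group_set : group_set automorphisms.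
Proof.
apply/group_setP; split=> [|g h].
  by rewrite inE; apply/forallP=> y; apply/forallP=> l; rewrite !perm1.
rewrite !inE => /forallP gP /forallP hP.
apply/forallP=> y; apply/forallP=> l; rewrite !permM.
by rewrite (eqP (forallP (hP _) _)) (eqP (forallP (gP _) _)).
Qed.

Canonical automorphisms_group := Group automorphisms_group_set.

Definition pact (y : point G) (g : permT G) : point G := g.1 y.

Lemma pact1 : pact^~ 1 =1 id.
Proof. by move=> y; rewrite /pact perm1. Qed.

Lemma pactM y : act_morph pact y.
Proof. by move=> g h; rewrite /pact permM. Qed.

Canonical pact_action := TotalAction pact1 pactM.

Definition symmetries (x : point G) : {set permT G} :=
  'C_automorphisms(perp x | pact_action).

Definition center_of_symmetry (x : point G) : Prop :=
  exists y z : point G,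
    [/\ y \in perp x, z \in perp x, ~~ collinear y z
      & [transitive symmetries x, on (perp y :&: perp z) :\ x | pact_action]].

Definition sharply_transitive (K : {set permT G}) (D : {set point G}) : Prop :=
  [acts K, on D | pact_action] /\
  forall y z, y \in D -> z \in D -> exists! g, g \in K /\ pact y g = z.

Definition EGQ (x : point G) (K : {group permT G}) : Prop :=
  [/\ thick_GQ,
      K \subset automorphisms,
      forall (g : permT G) (l : line G), g \in K -> inc x l -> g.2 l = l
    & sharply_transitive K (~: perp x)].

Definition STGQ (x : point G) (K : {group permT G}) : Prop :=
  [/\ EGQ x K, center_of_symmetry x & symmetries x \subset K].

End Geometry.

Section VspaceFinite.

Import VectorInternalTheory.

Variables (F : finFieldType) (vT : vectType F).

HB.instance Definition _ := [Countable of {vspace vT} by <:].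
HB.instance Definition _ := [Finite of {vspace vT} by <:].

End VspaceFinite.

Section SymplecticQuadrangle.

Local Open Scope ring_scope.

Variable F : finFieldType.

(* The standard nondegenerate alternating form on F^4,
     u0 v1 - u1 v0 + u2 v3 - u3 v2;
   all symplectic polarities of P^3(F) are equivalent to the one it defines. *)
Definition symp (u v : 'rV[F]_4) : F :=
  let c (w : 'rV[F]_4) k : F := w 0 (inord k) in
  c u 0%N * c v 1%N - c u 1%N * c v 0%N + c u 2%N * c v 3%N - c u 3%N * c v 2%N.

Definition totally_isotropic (U : {vspace 'rV[F]_4}) : bool :=
  [forall u, forall v, (u \in U) ==> (v \in U) ==> (symp u v == 0)].

Definition W_point := {U : {vspace 'rV[F]_4} | \dim U == 1%N}.

Definition W_line :=
  {U : {vspace 'rV[F]_4} | (\dim U == 2%N) && totally_isotropic U}.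

Definition W : geometry :=
  @Geometry W_point W_line (fun y l => (val y <= val l)%VS).

End SymplecticQuadrangle.

(* Main.v *)
(* Idea of the proof. Fix a point y not collinear with x. For each line l on x
   let A_l be the stabiliser in K of the line through y that meets l. The groups
   A_l and S have order t in the group K of order t^3, and the absence of
   triangles says that A_i A_j meets A_k trivially and that A_i S meets A_j
   trivially. The A_l S / S form a spread of K / S, so K / S is an elementary
   abelian p-group, and the union E of the A_l is a transversal of S in K.

   For fixed b <> 1 in A_i the S-part of b a runs through all of S when a runs
   through A_j. Hence a generator x of the cyclic group S can be written
   x = b a c^-1 with a, b, c in E. For p odd, taking p-th powers modulo x^(p^2)
   gives x^p = 1, so t = p. For p = 2 a parity argument in K modulo x^4 shows
   that K centralises S modulo x^4; then squaring gives t <= 4, and t = 4 is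
   excluded by following the pairs (b, a) whose S-part is the involution of S.

   When t = p, the S-part of b^i a^j is a scalar multiple of i j (if K were
   abelian with p odd, Wilson's theorem would be contradicted), so K is the
   Heisenberg group with its standard Kantor family. Its elements are then
   coordinates in F_p^4, in which collinearity is orthogonality for the
   symplectic form. *)

Require Import Defs.
From mathcomp Require Import all_boot all_order all_fingroup all_algebra.
From mathcomp Require Import all_solvable all_field.
From mathcomp Require Import zify ring.

Set Implicit Arguments.
Unset Strict Implicit.
Unset Printing Implicit Defensive.

Import GroupScope GRing.Theory.

(** * Cyclic normal subgroups and spreads *)

(** The obstacle is that K may a priori act nontrivially on S and have class greater than 2, so that
    no power formula is at hand. Working modulo x^(p^2) is the remedy: p-th powers of elements of K
    lie in the abelian group S, so conjugation raises x to an exponent congruent to 1 mod p, and x^p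
    becomes central in the quotient; its vanishing there already contradicts p^2 | t. For p = 2 the
    coefficient ['C(2, 2)] of the power formula is not divisible by p, and K may invert S modulo
    x^4; the dichotomy is whether some element of E does so. The geometric input is always the same:
    a product of nontrivial elements of two distinct A_i never lies in E, and S-parts in a row are
    distinct. At the end it is enough to give coordinates to points: in both geometries a line
    consists of the points collinear with two of its points, so the bijection on lines follows from
    collinearity. *)

Section FiniteFieldProducts.

Local Open Scope ring_scope.

(** Wilson's theorem: cancel ['X] in X^q - X = prod (X - m), evaluate at 0, and absorb the signs by
    reindexing m to -m. *)
Lemma prod_nonzero (F : finFieldType) : \prod_(m : F | m != 0) m = -1.
Proof.
have XqX := finField_genPoly F.
have prodX : 'X * (\prod_(m : F | m != 0) ('X - m%:P)) = 'X * ('X^(#|F|.-1) - 1) :> {poly F}.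
  rewrite mulrBr mulr1 -exprS prednK ?(ltnW (finNzRing_gt1 F)) // XqX.
  by rewrite [RHS](bigD1 0) //= subr0.
have /(congr1 (fun q : {poly F} => q.[0])) := mulfI (negbT (polyX_eq0 F)) prodX.
rewrite horner_prod !hornerE expr0n -subn1 subn_eq0 leqNgt finNzRing_gt1.
rewrite sub0r => <-.
rewrite [LHS](reindex_inj (@oppr_inj F)) /=.
by apply: eq_big => m; rewrite ?oppr_eq0 // !hornerE ?add0r ?opprK.
Qed.

Lemma prod_nonzero_inj (F : finFieldType) (h : F -> F) :
    (forall m, m != 0 -> h m != 0) -> {in predC1 0 &, injective h} ->
  \prod_(m | m != 0) h m = -1.
Proof.
move=> h_nz h_inj; pose h' m := if m == 0 then 0 else h m.
have h'E m : m != 0 -> h' m = h m by rewrite /h' => /negPf->.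
have h'0 m : (h' m == 0) = (m == 0).
  have [-> | nz_m] := eqVneq m 0; first by rewrite /h' !eqxx.
  by rewrite h'E // (negPf (h_nz m nz_m)).
have h'_inj : injective h'.
  move=> m n eq_mn; have [n0 | nz_n] := eqVneq n 0.
    by apply/eqP; rewrite n0 -h'0 eq_mn h'0 n0.
  have nz_m : m != 0 by rewrite -h'0 eq_mn h'0.
  by apply: h_inj; rewrite ?inE // -!h'E.
rewrite -(prod_nonzero F) [RHS](reindex_inj h'_inj) /=.
by apply: eq_big => m; rewrite ?h'0 // => /h'E.
Qed.

End FiniteFieldProducts.

(** A subtraction-free form of 2 ['C(n, 2)] = n (n - 1), which can be cast to ['F_t] in every
    characteristic. *)
Lemma bin2_double n : ('C(n, 2) * 2 + n = n * n)%N.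
Proof. by elim: n => // n IHn; rewrite binS bin1; lia. Qed.

(** * Powers with exponents in a prime field *)

Section PrimeExponents.

Variables (gT : finGroupType) (p : nat) (g : gT).
Hypothesis p_pr : prime p.
Hypothesis gp : g ^+ p = 1.

Lemma expg_natF n : g ^+ (n%:R%R : 'F_p) = g ^+ n.
Proof. by rewrite val_Fp_nat // expg_mod. Qed.

Lemma expgF_D (k l : 'F_p) : g ^+ (k + l)%R = g ^+ k * g ^+ l.
Proof.
by rewrite -[k in LHS]natr_Zp -[l in LHS]natr_Zp -natrD expg_natF expgD.
Qed.

Lemma expgF_X (k : 'F_p) n : (g ^+ k) ^+ n = g ^+ (n%:R * k)%R.
Proof. by rewrite -{2}[k]natr_Zp -natrM expg_natF -expgM mulnC. Qed.

Lemma expgF_N (k : 'F_p) : g ^+ (- k)%R = (g ^+ k)^-1.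
Proof.
by apply/eqP; rewrite eq_sym eq_invg_mul -expgF_D subrr.
Qed.

Lemma expgF_eq1 (k : 'F_p) : g != 1 -> (g ^+ k == 1) = (k == 0%R).
Proof.
move=> ntg; rewrite -order_dvdn (nt_prime_order p_pr gp ntg).
by rewrite (dvdn_pcharf (pchar_Fp p_pr)) natr_Zp.
Qed.

End PrimeExponents.

Section CyclicNormal.

Variables (gT : finGroupType) (K : {group gT}) (p : nat) (x : gT).
Hypothesis p_pr : prime p.
Hypothesis p_odd : odd p.
Hypothesis Kx : x \in K.
Hypothesis nxK : K \subset 'N(<[x]>).
Hypothesis derx : forall g h, g \in K -> h \in K -> [~ g, h] \in <[x]>.
Hypothesis powx : forall g, g \in K -> g ^+ p \in <[x]>.

Lemma conj_expn (g : gT) m n : x ^ g = x ^+ m -> x ^ (g ^+ n) = x ^+ (m ^ n).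
Proof.
move=> xg; elim: n => [|n IHn]; first by rewrite conjg1.
by rewrite expgSr conjgM IHn conjXg xg -expgM expnS.
Qed.

Lemma conj_cycle g : g \in K -> exists m, x ^ g = x ^+ m.
Proof.
move=> Kg; apply/cycleP.
by rewrite memJ_norm ?cycle_id // (subsetP nxK).
Qed.

(** Let [x ^ g = x ^+ m]. As [g ^+ p] is a power of [x], it commutes with [x]; so m^p = 1 modulo the
    order of [x], hence modulo p, and Fermat gives m = 1 modulo p. *)
Lemma conj_cycle_mod g : g \in K -> p %| #[x] ->
  exists k, x ^ g = x ^+ (1 + p * k).
Proof.
move=> Kg p_dv; have [m xg] := conj_cycle Kg.
suff m1 : m = 1 %[mod p].
  exists (m %/ p); rewrite xg {1}(divn_eq m p) m1 modn_small ?prime_gt1 //.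
  by rewrite addnC mulnC.
have := conj_expn p xg; rewrite conjgE.
have /cycleP[k ->] := powx Kg.
rewrite -expgS expgSr mulKg -[X in X = _]expg1 => /eqP.
rewrite eq_expg_mod_order => /eqP eq_mod.
rewrite -(fermat_little m p_pr); symmetry.
by rewrite -(modn_dvdm _ p_dv) eq_mod modn_dvdm.
Qed.

Hypothesis x_exp : x ^+ (p * p) = 1.

(** Suppose [x] has order p^2. Then [x ^+ p] commutes with all of K, and the commutators that occur
    lie in [<[x ^+ p]>], so p-th powers are multiplicative here. The p-th power of [b * a] is 1 and
    that of [x * c] is [x ^+ p]. *)
Lemma odd_expg_eq1 a b c :
    a \in K -> b \in K -> c \in K -> a ^+ p = 1 -> b ^+ p = 1 -> c ^+ p = 1 ->
  b * a = x * c -> x ^+ p = 1.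
Proof.
move=> Ka Kb Kc ap bp cp eq_ba.
have [// | ntxp] := eqVneq (x ^+ p) 1.
have ox : #[x] = (p * p)%N.
  have /(dvdn_pfactor _ _ p_pr)[k le_k2 ox] : #[x] %| p ^ 2.
    by rewrite -mulnn order_dvdn x_exp.
  case: k le_k2 ox => [|[|[|//]]] _ ox; last by rewrite ox -mulnn.
    by rewrite (eqP (etrans (esym (order_eq1 x)) (introT eqP ox))) expg1n eqxx in ntxp.
  by rewrite -order_dvdn ox expn1 dvdnn in ntxp.
have p_dv : p %| #[x] by rewrite ox dvdn_mulr.
have comx j g : g \in K -> exists k, [~ x ^+ j, g] = (x ^+ p) ^+ k.
  move=> Kg; have [k xg] := conj_cycle_mod Kg p_dv.
  exists (k * j)%N; rewrite commgEl conjXg xg -!expgM mulnDl mul1n.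
  by rewrite expgD mulKg mulnA.
have centx g : g \in K -> commute (x ^+ p) g.
  move=> Kg; apply/commgP; rewrite commgEl conjXg.
  have [k ->] := conj_cycle_mod Kg p_dv.
  by rewrite -expgM mulnDl mul1n expgD mulKg mulnAC expgM x_exp expg1n.
have centz z g : z \in <[x ^+ p]> -> g \in K -> commute g z.
  by case/cycleP=> k -> Kg; apply/commuteX/commute_sym/centx.
have powM u v : u \in K -> v \in K -> [~ v, u] \in <[x ^+ p]> ->
    (u * v) ^+ p = u ^+ p * v ^+ p.
  move=> Ku Kv z_uv; rewrite expMg_Rmul; try exact: centz.
  have [k ->] := cycleP _ _ z_uv.
  (* Oddness of p enters here: p divides ['C(p, 2)], which kills the commutator term. *)
  have /dvdnP[m ->] : p %| 'C(p, 2) by rewrite prime_dvd_bin //; case: (p) p_pr p_odd => [|[|[|]]].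
  by rewrite mulnC expgM (expgAC _ k) -(expgM x) x_exp !expg1n mulg1.
(* The conjugate u ^ g = u * [~ u, g] also has p-th power 1; comparing with the p-th power of u * x
   ^+ m forces p to divide m. *)
have comE u g : u \in K -> g \in K -> u ^+ p = 1 -> [~ u, g] \in <[x ^+ p]>.
  move=> Ku Kg up1; have /cycleP[m def_m] := derx Ku Kg.
  have : (u * x ^+ m) ^+ p = 1.
    by rewrite -def_m commgEl mulKVg -conjXg up1 conj1g.
  rewrite powM ?groupX // ?up1 ?mul1g; last first.
    by have [k ->] := comx m u Ku; rewrite mem_cycle.
  move/eqP; rewrite -expgM mulnC -order_dvdn => xpm.
  have: p %| m by rewrite -(dvdn_pmul2l (prime_gt0 p_pr)) -ox.
  by rewrite def_m; case/dvdnP=> k ->; rewrite mulnC expgM mem_cycle.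
have eq_p : (b * a) ^+ p = 1 by rewrite powM ?comE // ap bp mulg1.
by move: eq_p; rewrite eq_ba powM ?comE ?cp ?mulg1.
Qed.

End CyclicNormal.

(** * A group with a spread is elementary abelian *)

Section Spread.

Variables (gT : finGroupType) (Q : {group gT}) (I : finType).
Variable V : I -> {group gT}.
Hypothesis sVQ : forall i, V i \subset Q.
Hypothesis coverV : forall g, g \in Q -> exists i, g \in V i.
Hypothesis tiV : forall i j g, i != j -> g \in V i -> g \in V j -> g = 1.
Hypothesis mulV : forall i j, i != j -> V i * V j = Q.
Hypothesis ntV : forall i, V i :!=: 1.
Hypothesis I_gt2 : 2 < #|I|.

Lemma exists_other2 (i j : I) : exists k, (k != i) && (k != j).
Proof.
case: (pickP (fun k => (k != i) && (k != j))) => [k | no_k]; first by exists k.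
have: [set: I] \subset [set i; j].
  apply/subsetP=> k _; rewrite !inE; move/negbT: (no_k k).
  by rewrite negb_and !negbK.
move/subset_leq_card; rewrite cardsT cards2 => /(leq_trans I_gt2).
by case: (i != j).
Qed.

(** If h ^ g falls into another component V j, write g = a * b with a in V i and b in V j. Then h ^
    a lies in both components, so h = 1. *)
Lemma spread_normal i : Q \subset 'N(V i).
Proof.
apply/subsetP=> g Qg; rewrite inE; apply/subsetP=> _ /imsetP[h Vh ->].
have Qh := subsetP (sVQ i) h Vh.
have [j Vjhg] := coverV (groupJ Qh Qg).
have [<- // | neq_ji] := eqVneq j i.
have: g \in V i * V j by rewrite mulV // eq_sym.
case/mulsgP=> a b Va Vb def_g; move: Vjhg.
rewrite def_g conjgM memJ_norm ?(subsetP (normG _)) // => Vj_ha.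
have /eqP := tiV neq_ji Vj_ha (groupJ Vh Va).
by rewrite conjg_eq1 => /eqP->; rewrite !conj1g group1.
Qed.

Lemma spread_commute i j g h :
  i != j -> g \in V i -> h \in V j -> commute g h.
Proof.
move=> neq_ij Vg Vh; apply/commgP.
have Qg := subsetP (sVQ i) g Vg; have Qh := subsetP (sVQ j) h Vh.
apply/eqP; apply: (tiV neq_ij); rewrite commgEl.
  by rewrite groupM ?groupV // memJ_norm ?(subsetP (spread_normal i)).
by rewrite -commgEl commgEr groupM // memJ_norm ?(subsetP (spread_normal j)) ?groupV.
Qed.

(** For g and h in one component, multiply h by some b != 1 from another: both b and h * b lie
    outside the component of g, so they commute with g. *)
Lemma spread_abelian : abelian Q.
Proof.
apply/centsP=> g Qg h Qh.
have [i Vg] := coverV Qg; have [j Vh] := coverV Qh.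
have [def_j | neq_ij] := eqVneq i j; last exact: spread_commute neq_ij Vg Vh.
rewrite -{j}def_j in Vh.
have [k /andP[neq_ki _]] := exists_other2 i i.
have /trivgPn[b Vb nt_b] := ntV k.
have Qb := subsetP (sVQ k) b Vb.
have [m Vhb] := coverV (groupM Qh Qb).
have neq_mi : i != m.
  apply: contra_neq nt_b => def_m; apply: (tiV neq_ki) => //.
  by rewrite -(groupMl _ Vh) def_m.
have cgb : commute g b by rewrite /commute (spread_commute _ Vg Vb) // eq_sym.
have cghb := spread_commute neq_mi Vg Vhb.
by rewrite -[h](mulgK b); apply: commuteM => //; apply: commuteV.
Qed.

(** An element b of order p forces a ^+ p = 1 for every a outside its component: a ^+ p = (a * b) ^+
    p lies in the components of a and of a * b, which differ. A second such element handles the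
    component of b itself. *)
Lemma spread_abelem p : p \in \pi(Q) -> p.-abelem Q.
Proof.
move=> piQp; have p_pr : prime p by move: piQp; rewrite mem_primes => /and3P[].
have powV i b a : b \in V i -> b != 1 -> b ^+ p = 1 -> a \in Q -> a \notin V i -> a ^+ p = 1.
  move=> Vb ntb bp Qa Via; have [j Va] := coverV Qa.
  have Qb := subsetP (sVQ i) b Vb.
  have [k Vab] := coverV (groupM Qa Qb).
  have neq_ij : i != j by apply: contraNneq Via => ->.
  have cab : commute a b by apply: (centsP spread_abelian).
  have neq_kj : k != j.
    apply: contra_neq ntb => def_k; apply: (tiV neq_ij) => //.
    by rewrite -(groupMl _ Va) -def_k.
  apply: (tiV neq_kj); last exact: groupX.
  have -> : a ^+ p = (a * b) ^+ p by rewrite expgMn // bp mulg1.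
  exact: groupX.
have pQ : p %| #|Q| by move: piQp; rewrite mem_primes => /and3P[].
have [b Qb ob] := Cauchy p_pr pQ.
have ntb : b != 1 by rewrite -order_eq1 ob; case: eqP p_pr => // ->.
have bp : b ^+ p = 1 by rewrite -ob expg_order.
have [i Vb] := coverV Qb.
rewrite abelemE // spread_abelian; apply/exponentP=> a Qa.
have [Va | ] := boolP (a \in V i); last exact: (powV i b).
have [k /andP[neq_ki _]] := exists_other2 i i.
have /trivgPn[c Vc nt_c] := ntV k; have Qc := subsetP (sVQ k) c Vc.
have cp : c ^+ p = 1.
  by apply: (powV i b) => //; apply: contra_neqN nt_c => Vic; apply: (tiV neq_ki).
have [-> | nta] := eqVneq a 1; first by rewrite expg1n.
by apply: (powV k c) => //; apply: contra_neqN nta => Vka; apply: (tiV neq_ki).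
Qed.

End Spread.

(** * Kantor families with a cyclic subgroup S *)

(** With t = n + 1 this is t^3 - t = (t + 1)(t - 1)t, the count behind [decomp]. *)
Lemma cube_sub n : (n.+1 ^ 3 - n.+1 = n.+2 * n * n.+1)%N.
Proof. by rewrite !expnS; nia. Qed.

Section Kantor.

Variables (gT : finGroupType) (K S : {group gT}) (I : finType).
Variables (A : I -> {group gT}) (t : nat).
Hypothesis nSK : S <| K.
Hypothesis cycS : cyclic S.
Hypothesis sAK : forall i, A i \subset K.
Hypothesis t_gt1 : 1 < t.
Hypothesis oS : #|S| = t.
Hypothesis oA : forall i, #|A i| = t.
Hypothesis oK : #|K| = (t ^ 3)%N.
Hypothesis oI : #|I| = t.+1.
Hypothesis tangency : forall i j a b s,
  i != j -> a \in A i -> b \in A j -> s \in S -> a = b * s -> a = 1.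
Hypothesis triangle : forall i j k a b c,
  i != j -> i != k -> j != k -> a \in A i -> b \in A j -> c \in A k ->
  a * b = c -> c = 1.

Let sSK : S \subset K. Proof. by case/andP: nSK. Qed.
Let nSKs : K \subset 'N(S). Proof. by case/andP: nSK. Qed.

Definition transv : {set gT} := \bigcup_i A i.

Lemma transvP c : reflect (exists i, c \in A i) (c \in transv).
Proof.
by apply: (iffP bigcupP) => [[i _ Ac] | [i Ac]]; exists i.
Qed.

Lemma mem_transv i c : c \in A i -> c \in transv.
Proof. by move=> Ac; apply/transvP; exists i. Qed.

Lemma transv_sub : transv \subset K.
Proof. by apply/bigcupsP=> i _. Qed.

Lemma exists_other (i : I) : exists j, j != i.
Proof.
have I_gt2 : 2 < #|I| by rewrite oI !ltnS.
by have [j /andP[neq_ji _]] := exists_other2 I_gt2 i i; exists j.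
Qed.

Lemma A_TI i j a : i != j -> a \in A i -> a \in A j -> a = 1.
Proof. by move=> ij Ai Aj; apply: (tangency (s := 1) ij Ai Aj); rewrite ?mulg1. Qed.

Lemma AS_TI i a : a \in A i -> a \in S -> a = 1.
Proof.
move=> Aa Sa; have [j neq_ji] := exists_other i.
rewrite eq_sym in neq_ji.
by apply: (tangency neq_ji Aa (group1 (A j)) Sa); rewrite mul1g.
Qed.

Lemma transvS c : c \in transv -> c \in S -> c = 1.
Proof. by case/transvP=> i; apply: AS_TI. Qed.

(** If c and c' share a component, c'^-1 * c lies in it and in S. Otherwise c lies in A j * S, so
    tangency gives c = 1, and then c' is in S. *)
Lemma decomp_inj s s' c c' :
    s \in S -> s' \in S -> c \in transv -> c' \in transv ->
  s * c = s' * c' -> s = s' /\ c = c'.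
Proof.
move=> Ss Ss' Ec Ec' eq_sc.
have Kc' := subsetP transv_sub _ Ec'.
suff eq_c : c = c' by move: eq_sc; rewrite eq_c => /mulIg->.
have def_c : c = c' * (s^-1 * s') ^ c'.
  by rewrite -conjgC -mulgA -eq_sc mulKg.
have Sconj : (s^-1 * s') ^ c' \in S.
  by rewrite memJ_norm ?(subsetP nSKs) // groupM ?groupV.
case/transvP: (Ec) => i Ac; case/transvP: (Ec') => j Ac'.
have [def_j | neq_ij] := eqVneq i j.
  rewrite -{}def_j in Ac'; apply/esym/eqP; rewrite eq_mulVg1.
  apply/eqP/(AS_TI (i := i)).
    by rewrite groupM ?groupV.
  by rewrite def_c mulKg.
have c1 := tangency neq_ij Ac Ac' Sconj def_c.
move: Sconj def_c; rewrite c1 => Sconj /esym/eqP; rewrite -eq_invg_mul => /eqP def_s.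
by symmetry; apply: (AS_TI Ac'); rewrite -groupV def_s.
Qed.

(** By counting: the (t + 1)(t - 1) nontrivial elements of the A i, multiplied by the t elements of
    S, inject into [K :\: S], which has t^3 - t elements. Elements of S take c = 1. *)
Lemma decomp g : g \in K -> exists s c, [/\ s \in S, c \in transv & g = s * c].
Proof.
move=> Kg; have [Sg | nSg] := boolP (g \in S).
  exists g, 1; rewrite mulg1; split=> //.
  have [i _] : exists i, i \in [set: I] by apply/card_gt0P; rewrite cardsT oI.
  by apply: (@mem_transv i).
pose Y := [set u : I * gT | u.2 \in (A u.1)^#].
pose f (u : I * gT * gT) := u.2 * u.1.2.
have oY : #|Y| = (t.+1 * t.-1)%N.
  rewrite -sum1dep_card -(pair_big_dep xpredT (fun i a => a \in (A i)^#) (fun _ _ => 1%N)) /=.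
  under eq_bigr => i _ do rewrite sum1_card.
  rewrite (eq_bigr (fun=> t.-1)) ?sum_nat_const ?oI // => i _.
  by have := cardsD1 1 (A i); rewrite group1 oA => ->.
have injf : {in setX Y S &, injective f}.
  move=> [[i a] s] [[j b] s']; rewrite !inE /= -!andbA.
  case/and3P=> nta Aa Ss /and3P[ntb Ab Ss'] eq_f.
  have [-> def_a] := decomp_inj Ss Ss' (mem_transv Aa) (mem_transv Ab) eq_f.
  congr (_, _, _) => //; apply: contra_neq_eq nta => neq_ij.
  by apply: (A_TI neq_ij Aa); rewrite def_a.
have sfK : f @: setX Y S \subset K :\: S.
  apply/subsetP=> _ /imsetP[[[i a] s] + ->]; rewrite !inE /= -andbA.
  case/and3P=> nta Aa Ss; rewrite (groupM (subsetP sSK s Ss) (subsetP (sAK i) a Aa)) andbT.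
  by rewrite groupMl //; apply: contra nta => Sa; apply/eqP/(AS_TI Aa).
have: g \in f @: setX Y S.
  suff ->: f @: setX Y S = K :\: S by rewrite inE nSg.
  apply/eqP; rewrite eqEcard sfK card_in_imset // cardsX oY oS.
  rewrite cardsD (setIidPr sSK) oK oS; case: (t) t_gt1 => // n _ /=.
  by rewrite cube_sub.
case/imsetP=> [[[i a] s]]; rewrite !inE /= -andbA => /and3P[_ Aa Ss] ->.
by exists s, a; rewrite Ss (mem_transv Aa).
Qed.

Lemma card_quo i : #|A i / S| = t.
Proof.
rewrite -(oA i) -(card_isog (quotient_isog _ _)) ?(subset_trans (sAK i)) //.
by apply/trivgP/subsetP=> a /setIP[Sa Aa]; rewrite inE (AS_TI Aa Sa).
Qed.

Lemma quo_TI i j g : i != j -> g \in A i / S -> g \in A j / S -> g = 1.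
Proof.
move=> neq_ij /morphimP[a Na Aa ->] /morphimP[b Nb Ab] eq_ab.
have: a \in coset S b by rewrite -eq_ab /= val_coset // rcoset_refl.
rewrite /= val_coset // norm_rlcoset // => /lcosetP[s Ss def_a].
by rewrite (tangency neq_ij Aa Ab Ss def_a) morph1.
Qed.

Lemma quo_mul i j : i != j -> (A i / S) * (A j / S) = K / S.
Proof.
move=> neq_ij; apply/eqP; rewrite eqEcard mul_subG ?quotientS //=.
rewrite TI_cardMg ?card_quo; last first.
  by apply/trivgP/subsetP=> g /setIP[gi gj]; rewrite inE (quo_TI neq_ij gi gj).
rewrite card_quotient // -divgS // oK oS expnS mulKn ?(ltnW t_gt1) //.
Qed.

Lemma quo_cover g : g \in K / S -> exists i, g \in A i / S.
Proof.
case/morphimP=> h Nh Kh ->; have [s [c [Ss /transvP[i Ac] ->]]] := decomp Kh.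
have Nc : c \in 'N(S) by rewrite (subsetP nSKs) ?(subsetP (sAK i)).
exists i; rewrite mkerl ?mem_quotient //.
by rewrite ker_coset.
Qed.

Lemma quo_abelem p : p \in \pi(K / S) -> p.-abelem (K / S).
Proof.
apply: (@spread_abelem _ _ _ (fun i => (A i / S)%G)) => [i|||||].
- exact: quotientS.
- exact: quo_cover.
- exact: quo_TI.
- exact: quo_mul.
- by move=> i; rewrite -cardG_gt1 /= card_quo.
- by rewrite oI.
Qed.

Let p := pdiv t.
Let p_pr : prime p. Proof. exact: pdiv_prime. Qed.

Lemma card_K_quo : #|K / S| = (t ^ 2)%N.
Proof.
by rewrite card_quotient // -divgS // oK oS expnS mulKn ?(ltnW t_gt1).
Qed.

Lemma quo_abelem_pdiv : p.-abelem (K / S).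
Proof.
apply: quo_abelem; rewrite /= card_K_quo pi_of_exp // mem_primes p_pr pdiv_dvd.
by rewrite ltnW.
Qed.

Lemma t_pnat : p.-nat t.
Proof.
by have := abelem_pgroup quo_abelem_pdiv; rewrite /pgroup card_K_quo pnatX orbF.
Qed.

Lemma der_sub g h : g \in K -> h \in K -> [~ g, h] \in S.
Proof.
move=> Kg Kh; apply: (subsetP _ _ (mem_commg Kg Kh)); apply: der1_min => //.
by case/and3P: quo_abelem_pdiv.
Qed.

Lemma pow_sub g : g \in K -> g ^+ p \in S.
Proof.
move=> Kg; have Ng := subsetP nSKs g Kg.
apply: coset_idr; first exact: groupX.
have [_ expQ] := abelemP p_pr quo_abelem_pdiv.
by rewrite morphX // expQ // mem_quotient.
Qed.

Lemma transvX c : c \in transv -> c ^+ p = 1.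
Proof.
move=> Ec; case/transvP: (Ec) => i Ac; apply: (AS_TI (i := i)); first exact: groupX.
by apply: pow_sub; apply: (subsetP transv_sub).
Qed.

Lemma tangencyl i j b d s :
  i != j -> b \in A i -> d \in A j -> s \in S -> b = s * d -> b = 1.
Proof.
move=> neq_ij Ab Ad Ss def_b; apply: (tangency neq_ij Ab Ad (s := s ^ d)).
  by rewrite memJ_norm ?(subsetP nSKs) ?(subsetP (sAK j)).
by rewrite -conjgC.
Qed.

(** For a != a' the equation c * (a^-1 * a') = c' is a forbidden triangle on A k, A j and A m.
    Neither k nor m can be j, since that would put b in S * A j. *)
Lemma row_inj i j b a a' s c c' :
    i != j -> b \in A i -> b != 1 -> a \in A j -> a' \in A j ->
    s \in S -> c \in transv -> c' \in transv ->
  b * a = s * c -> b * a' = s * c' -> a = a'.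
Proof.
move=> neq_ij Ab ntb Aa Aa' Ss /transvP[k Ac] /transvP[m Ac'] def_c def_c'.
have ntv d e l : d \in A l -> e \in A j -> b * e = s * d -> l != j.
  move=> Ad Ae eq_be; apply: contra_neq ntb => def_l.
  apply: (@tangencyl i j b (d * e^-1) s) => //.
    by rewrite groupM ?groupV // -def_l.
  by rewrite mulgA -eq_be mulgK.
have neq_kj := ntv _ _ _ Ac Aa def_c; have neq_mj := ntv _ _ _ Ac' Aa' def_c'.
have eq_c : c * (a^-1 * a') = c'.
  by apply: (@mulgI _ s); rewrite !mulgA -def_c mulgK.
apply/eqP; rewrite eq_mulVg1; apply/eqP.
have Ad : a^-1 * a' \in A j by rewrite groupM ?groupV.
have [def_m | neq_km] := eqVneq k m.
  apply: (A_TI _ Ad (j := k)); first by rewrite eq_sym.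
  by rewrite -(groupMl _ Ac) eq_c def_m.
have c'1 : c' = 1 by rewrite (triangle neq_kj neq_km _ Ac Ad Ac' eq_c) // eq_sym.
case/eqP: ntb; apply: (@tangencyl i j b a'^-1 s) => //; first by rewrite groupV.
by apply: (canRL (mulgK _)); rewrite def_c' c'1 mulg1.
Qed.

(** The default 1 is never reached for g in K, by [decomp]. *)
Definition spart g : gT := odflt 1 [pick s in S | s^-1 * g \in transv].

Lemma spartE s c : s \in S -> c \in transv -> spart (s * c) = s.
Proof.
move=> Ss Ec; rewrite /spart; case: pickP => [s' /andP[Ss' Ec'] | /(_ s)] /=.
  by have [] := decomp_inj Ss' Ss Ec' Ec (mulKVg _ _).
by rewrite Ss mulKg Ec.
Qed.

Lemma spartP g : g \in K -> spart g \in S /\ exists2 c, c \in transv & g = spart g * c.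
Proof.
by case/decomp=> s [c [Ss Ec ->]]; rewrite spartE //; split=> //; exists c.
Qed.

Lemma spart_inj i j b : i != j -> b \in A i -> b != 1 ->
  {in A j &, injective (fun a => spart (b * a))}.
Proof.
move=> neq_ij Ab ntb a a' Aa Aa' /= eq_s.
have KA l e : e \in A l -> e \in K by apply: (subsetP (sAK l)).
have [Ss [c Ec def_c]] := spartP (groupM (KA _ _ Ab) (KA _ _ Aa)).
have [_ [c' Ec' def_c']] := spartP (groupM (KA _ _ Ab) (KA _ _ Aa')).
by apply: (row_inj neq_ij Ab ntb Aa Aa' Ss Ec Ec' def_c); rewrite eq_s.
Qed.

(** [spart_inj] is an injection of A j into S, and both have order t. *)
Lemma spart_onto i j b s : i != j -> b \in A i -> b != 1 -> s \in S ->
  exists a c, [/\ a \in A j, c \in transv & b * a = s * c].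
Proof.
move=> neq_ij Ab ntb Ss.
have KA l e : e \in A l -> e \in K by apply: (subsetP (sAK l)).
have: s \in [set spart (b * a) | a in A j].
  suff /eqP-> : [set spart (b * a) | a in A j] == S by [].
  rewrite eqEcard card_in_imset ?oA ?oS ?leqnn ?andbT; last exact: (spart_inj neq_ij Ab ntb).
  apply/subsetP=> _ /imsetP[a Aa ->].
  by have [] := spartP (groupM (KA _ _ Ab) (KA _ _ Aa)).
case/imsetP=> a Aa def_s.
have [_ [c Ec def_c]] := spartP (groupM (KA _ _ Ab) (KA _ _ Aa)).
by exists a, c; rewrite {1}def_s -def_c.
Qed.

Lemma triple_of_generator s : s \in S -> exists i j b a c,
  [/\ i != j, b \in A i, a \in A j, c \in transv & b * a = s * c /\ b != 1].
Proof.
move=> Ss; have [i _] : exists i, i \in [set: I] by apply/card_gt0P; rewrite cardsT oI.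
have [j neq_ji] := exists_other i; rewrite eq_sym in neq_ji.
have /trivgPn[b Ab ntb] : A i :!=: 1 by rewrite -cardG_gt1 oA.
have [a [c [Aa Ec eq_ba]]] := spart_onto neq_ji Ab ntb Ss.
by exists i, j, b, a, c.
Qed.

(** Modulo [x ^+ (p * p)] the power argument applies to b * a = x * c, so [x ^+ p] lies in
    [<[x ^+ (p * p)]>]; this is impossible if p * p divides t. *)
Lemma odd_prime : odd p -> t = p.
Proof.
move=> p_odd; have /cyclicP[x defS] := cycS.
have ox : #[x] = t by rewrite -oS defS.
have Sx : x \in S by rewrite defS cycle_id.
have [i [j [b [a [c [_ Ab Aa Ec [eq_ba _]]]]]]] := triple_of_generator Sx.
pose N := <[x ^+ (p * p)]>%G.
have sNS : N \subset S by rewrite /= cycle_subG groupX.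
have nNK : K \subset 'N(N).
  by apply: char_norm_trans (nSKs); rewrite sub_cyclic_char.
have in_E e : e \in transv -> e \in K by apply: (subsetP transv_sub).
have [[Kb Ka] Kc] := (in_E _ (mem_transv Ab), in_E _ (mem_transv Aa), in_E _ Ec).
have Kx := subsetP sSK x Sx.
have N_ := subsetP nNK.
have qX e : e \in transv -> coset N e ^+ p = 1.
  by move=> Ee; rewrite -morphX ?transvX ?morph1 // N_ ?in_E.
have qS : <[coset N x]> = S / N by rewrite defS quotient_cycle ?N_.
have xp : coset N x ^+ p = 1.
  apply: (@odd_expg_eq1 _ (K / N)%G p (coset N x) p_pr p_odd _ _ _ _ _
           (coset N a) (coset N b) (coset N c)).
  - exact: mem_quotient.
  - by rewrite qS quotient_norms.
  - move=> _ _ /morphimP[g Ng Kg ->] /morphimP[h Nh Kh ->].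
    by rewrite -morphR // qS mem_quotient // der_sub.
  - move=> _ /morphimP[g Ng Kg ->].
    by rewrite -morphX // qS mem_quotient // pow_sub.
  - by rewrite -morphX ?N_ //= coset_id // cycle_id.
  - exact: mem_quotient.
  - exact: mem_quotient.
  - exact: mem_quotient.
  - by rewrite qX // (mem_transv Aa).
  - by rewrite qX // (mem_transv Ab).
  - exact: qX.
  - by rewrite -!morphM ?N_ ?eq_ba.
have: x ^+ p \in N.
  by rewrite coset_idr ?groupX ?N_ // morphX ?N_.
case/cycleP=> k /eqP; rewrite -expgM eq_expg_mod_order ox => eq_mod.
have p_dv : p %| t by exact: pdiv_dvd.
have [n def_t] := p_natP t_pnat.
case: n def_t => [t1 | [|n] def_t]; first by have := t_gt1; rewrite t1.
  by rewrite def_t expn1.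
suff: p * p %| p by rewrite -{3}[p]muln1 dvdn_pmul2l ?prime_gt0 // dvdn1; case: eqP p_pr => // ->.
have p2t : p * p %| t by rewrite def_t mulnn dvdn_exp2l.
move/eqP/(congr1 (modn^~ (p * p)%N)): eq_mod; rewrite !modn_dvdm // => eq_mod.
by rewrite /dvdn eq_mod modnMr.
Qed.

Lemma decomp3 i j g : i != j -> g \in K ->
  exists s b a, [/\ s \in S, b \in A i, a \in A j & s * g = b * a].
Proof.
move=> neq_ij Kg; have := mem_quotient S Kg; rewrite -(quo_mul neq_ij).
have KA l e : e \in A l -> e \in K by apply: (subsetP (sAK l)).
case/mulsgP=> _ _ /morphimP[b Nb Ab ->] /morphimP[a Na Aa ->] eq_g.
exists (b * a * g^-1), b, a; split=> //; last by rewrite mulgKV.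
have [Kb Ka] := (KA _ _ Ab, KA _ _ Aa).
rewrite coset_idr ?(subsetP nSKs) ?groupM ?groupV //.
by rewrite !morphM ?morphV ?(subsetP nSKs) ?groupM ?groupV //= -eq_g mulgV.
Qed.

(** Merges [triangle] with [A_TI], so that the component of the product may also be i or j. *)
Lemma no_tri i j b a :
  i != j -> b \in A i -> a \in A j -> b * a \in transv -> b = 1 \/ a = 1.
Proof.
move=> neq_ij Ab Aa /transvP[k Ac].
have [def_k | neq_ik] := eqVneq i k.
  right; apply: (A_TI neq_ij _ Aa).
  by rewrite -(groupMl _ Ab) def_k.
have [def_k | neq_jk] := eqVneq j k.
  by left; apply: (A_TI neq_ij Ab); rewrite -(groupMr _ Aa) def_k.
have ba1 := triangle neq_ij neq_ik neq_jk Ab Aa Ac (erefl _).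
left; apply: (A_TI neq_ij Ab).
by move/eqP: ba1; rewrite -eq_invg_mul => /eqP def_a; rewrite -groupV def_a.
Qed.

(** * The case p = 2 with 4 dividing t *)

Section Two.

Variable x : gT.
Hypothesis p2 : p = 2.
Hypothesis t4 : 4 %| t.
Hypothesis defS : S = <[x]> :> {set gT}.

Let EK e : e \in transv -> e \in K.
Proof. exact: (subsetP transv_sub). Qed.

Let SK s : s \in S -> s \in K.
Proof. exact: (subsetP sSK). Qed.

Let Sx : x \in S. Proof. by rewrite defS cycle_id. Qed.

Let ox : #[x] = t. Proof. by rewrite -oS defS. Qed.

Let inv2 c : c \in transv -> c * c = 1.
Proof. by move=> Ec; have := transvX Ec; rewrite p2. Qed.

Let invE c : c \in transv -> c^-1 = c.
Proof. by move/inv2/eqP; rewrite -eq_invg_mul => /eqP. Qed.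

Let sq : {set gT} := <[x ^+ 2]>.
Let N := <[x ^+ 4]>%G.

Let nNK : K \subset 'N(N).
Proof.
have sNS : N \subset S by rewrite /= cycle_subG groupX.
by apply: char_norm_trans (nSKs); rewrite sub_cyclic_char.
Qed.

Local Notation f := (coset N).

Let fM g h : g \in K -> h \in K -> f (g * h) = f g * f h.
Proof. by move=> Kg Kh; rewrite morphM ?(subsetP nNK). Qed.

Let fxX k : f (x ^+ k) = f x ^+ k.
Proof. by rewrite morphX // (subsetP nNK) ?SK. Qed.

Let fx_eq1 k : (f x ^+ k == 1) = (4 %| k).
Proof.
rewrite -fxX; apply/eqP/idP=> [fxk | /dvdnP[m ->]].
  have: x ^+ k \in N by rewrite coset_idr ?(subsetP nNK) ?groupX ?SK.
  case/cycleP=> m /eqP; rewrite -expgM eq_expg_mod_order ox => /eqP eq_mod.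
  have /eqP : k = 4 * m %[mod 4] by rewrite -(modn_dvdm _ t4) eq_mod modn_dvdm.
  by rewrite modnMr.
by rewrite mulnC expgM coset_id // mem_cycle.
Qed.

Let sqP k : (x ^+ k \in sq) = ~~ odd k.
Proof.
have t2 : 2 %| t by apply: dvdn_trans t4.
apply/cycleP/idP=> [[m /eqP] | ev_k]; last first.
  by exists k./2; rewrite -expgM mul2n -[k in LHS]odd_double_half (negPf ev_k).
rewrite -expgM eq_expg_mod_order ox => /eqP eq_mod.
have : k = 2 * m %[mod 2] by rewrite -(modn_dvdm _ t2) eq_mod modn_dvdm.
by rewrite modnMr modn2; case: odd.
Qed.

(** Being a square in S can be read off modulo [x ^+ 4], where the image of [x] has order 4. *)
Let sq_sqr s : s \in S -> (f s * f s == 1) = (s \in sq).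
Proof.
rewrite defS => /cycleP[k ->]; rewrite fxX -expgD fx_eq1 sqP addnn -mul2n.
by rewrite (@dvdn_pmul2l 2 2) // dvdn2.
Qed.

Let nonsqM s s' : s \in S -> s' \in S -> s \notin sq -> (s * s' \in sq) = (s' \notin sq).
Proof.
rewrite defS => /cycleP[k ->] /cycleP[m ->]; rewrite -expgD !sqP oddD negbK.
by move=> ->.
Qed.

Let sqN s n : s \in S -> n \in S -> f n = 1 -> (s * n \in sq) = (s \in sq).
Proof.
rewrite defS => /cycleP[k ->] /cycleP[m ->] /eqP; rewrite fxX fx_eq1 -expgD !sqP oddD.
by move=> m4; rewrite -[odd m]negbK -dvdn2 (dvdn_trans _ m4) //= addbF.
Qed.

(* The index-two subgroup of K centralising S modulo its fourth powers. *)
Let h g := f g \in 'C[f x].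

(** A cyclic group of order 4 has two automorphisms, the identity and inversion. *)
Let fx_conj g : g \in K -> f x ^ f g = f x ^+ (if h g then 1 else 3)%N.
Proof.
move=> Kg; have nxK : K \subset 'N(<[x]>) by rewrite -defS.
have [m xg] := conj_cycle nxK Kg.
have fxg : f x ^ f g = f x ^+ m.
  by rewrite -fxX -xg morphJ ?(subsetP nNK) ?(SK Sx).
have m_odd : odd m.
  rewrite -[odd m]negbK -dvdn2; apply/negP=> m2.
  have: f x ^+ 2 ^ f g == 1.
    by rewrite conjXg fxg -expgM fx_eq1 (@dvdn_mul 2 2).
  by rewrite conjg_eq1 fx_eq1.
have -> : h g = (f x ^ f g == f x).
  by rewrite /h cent1E conjgE -[RHS](inj_eq (mulgI (f g))) mulKVg.
have fxm : f x ^+ m = f x ^+ (m %% 4).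
  rewrite {1}(divn_eq m 4) expgD mulnC expgM (_ : f x ^+ 4 = 1) ?expg1n ?mul1g //.
  by apply/eqP; rewrite fx_eq1.
rewrite fxg fxm; have : odd (m %% 4) by rewrite odd_mod.
have: m %% 4 < 4 by rewrite ltn_mod.
case: (m %% 4) => [|[|[|[|]]]] // _ _; first by rewrite expg1 eqxx.
case: eqP => // /eqP; rewrite expgS -{3}[f x]mulg1 (inj_eq (mulgI _)).
Qed.

Let hS s : s \in S -> h s.
Proof.
rewrite defS => /cycleP[k ->]; rewrite /h fxX.
by apply/cent1P/commute_sym/commuteX.
Qed.

Let hM g g' : g \in K -> g' \in K -> h g -> h (g * g') = h g'.
Proof. by move=> Kg Kg' hg; rewrite /h fM // groupMl. Qed.

Let hMr g g' : g \in K -> g' \in K -> h g' -> h (g * g') = h g.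
Proof. by move=> Kg Kg' hg; rewrite /h fM // groupMr. Qed.

Let hNM g g' : g \in K -> g' \in K -> ~~ h g -> ~~ h g' -> h (g * g').
Proof.
move=> Kg Kg' nhg nhg'; have := fx_conj (groupM Kg Kg').
rewrite fM // conjgM fx_conj // (negPf nhg) conjXg fx_conj // (negPf nhg') -expgM.
case: ifP => // _; rewrite (_ : 3 * 3 = 6 + 3)%N // expgD -[X in _ = X]mul1g.
by move/mulIg/eqP; rewrite fx_eq1.
Qed.

Let fsX s g : s \in S -> g \in K -> h g -> commute (f s) (f g).
Proof.
rewrite defS => /cycleP[k ->] _ /cent1P cgx; rewrite fxX.
exact/commute_sym/commuteX.
Qed.

Let fsV s g : s \in S -> g \in K -> ~~ h g -> f s ^ f g = (f s)^-1.
Proof.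
rewrite defS => /cycleP[k ->] Kg nhg.
rewrite fxX conjXg fx_conj // (negPf nhg) -expgM mulnC expgM.
apply/eqP; rewrite eq_sym eq_invg_mul -expgS -expgM fx_eq1.
exact: dvdn_mull.
Qed.

Let fE2 e : e \in transv -> f e * f e = 1.
Proof. by move=> Ee; rewrite -fM ?EK // inv2 // morph1. Qed.

Let invol_comm (rT : finGroupType) (u v : rT) :
  u * u = 1 -> v * v = 1 -> u * v * (u * v) = 1 -> commute u v.
Proof.
move=> /eqP u2 /eqP v2 /eqP; rewrite -!eq_invg_mul in u2 v2 *.
by move/eqP; rewrite invMg (eqP u2) (eqP v2).
Qed.

Let decompE g : g \in K -> exists s c, [/\ s \in S, c \in transv, g = s * c & h g = h c].
Proof.
move=> Kg; have [s [c [Ss Ec def_g]]] := decomp Kg.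
by exists s, c; split=> //; rewrite def_g (hM (SK Ss) (EK Ec) (hS Ss)).
Qed.

(** Write b * e = s * c. Then c inverts S modulo [x ^+ 4], so there the square of s * c is s * s^-1
    = 1, and elements squaring to 1 whose product squares to 1 commute. *)
Let commEn b e : b \in transv -> h b -> e \in transv -> ~~ h e -> commute (f b) (f e).
Proof.
move=> Eb hb Ee nhe; apply: invol_comm; try exact: fE2.
have [Kb Ke] := (EK Eb, EK Ee).
have [s [c [Ss Ec def_be hbe]]] := decompE (groupM Kb Ke).
have nhc : ~~ h c by rewrite -hbe hM.
have Kc := EK Ec; have Ks := SK Ss.
rewrite -[f b * f e]fM // def_be fM // -mulgA (mulgA (f c)).
have fcV : (f c)^-1 = f c by apply/eqP; rewrite eq_invg_mul fE2.
by rewrite -{1}fcV -mulgA (mulgA _ _ (f c)) -mulgA -conjgE fsV // mulgV.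
Qed.

(** * Some element of E inverts S modulo x^4 *)

Section TwistedCase.

Variable e0 : gT.
Hypothesis Ee0 : e0 \in transv.
Hypothesis nhe0 : ~~ h e0.

Let commE b g : b \in transv -> h b -> g \in K -> commute (f b) (f g).
Proof.
move=> Eb hb Kg; have [s [c [Ss Ec -> _]]] := decompE Kg.
have csb s' : s' \in S -> commute (f b) (f s').
  by move=> Ss'; apply/commute_sym/fsX => //; apply: EK.
have Kc := EK Ec; rewrite fM ?(SK Ss) //; apply: commuteM; first exact: csb.
have [hc | nhc] := boolP (h c); last exact: commEn.
have [Ke0 Kb] := (EK Ee0, EK Eb).
have [s' [c' [Ss' Ec' def_e0c he0c]]] := decompE (groupM Ke0 Kc).
have nhc' : ~~ h c' by rewrite -he0c hMr.
have -> : f c = f e0 * (f s' * f c').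
  rewrite -fM ?(SK Ss') ?EK // -def_e0c -fM ?groupM //.
  by rewrite mulgA inv2 // mul1g.
by apply: commuteM; [apply: commEn | apply: commuteM; [apply: csb | apply: commEn]].
Qed.

Let spart_sq b a s c : b \in transv -> h b -> a \in transv -> h a ->
  s \in S -> c \in transv -> b * a = s * c -> s \in sq.
Proof.
move=> Eb hb Ea ha Ss Ec eq_ba.
have [[Kb Ka] [Ks Kc]] := ((EK Eb, EK Ea), (SK Ss, EK Ec)).
have hc : h c by rewrite -(hM Ks Kc (hS Ss)) -eq_ba hM.
rewrite -sq_sqr //; apply/eqP.
have: (f b * f a) ^+ 2 = (f s * f c) ^+ 2 by rewrite -!fM // eq_ba.
have e2 (u : coset_of N) : u ^+ 2 = u * u by [].
rewrite (expgMn _ (commE Eb hb Ka)) (expgMn _ (fsX Ss Kc hc)) !e2.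
by rewrite (fE2 Eb) (fE2 Ea) (fE2 Ec) !mulg1.
Qed.

(* The square S-parts are exhausted by the index-two subgroup of A j on which h
   holds, so the remaining elements of A j have non-square S-parts. *)
Let spart_nonsq i j b a s c : i != j -> b \in A i -> b != 1 -> h b ->
    a \in A j -> ~~ h a -> s \in S -> c \in transv -> b * a = s * c ->
  s \notin sq.
Proof.
move=> neq_ij Ab ntb hb Aa nha Ss Ec eq_ba; apply/negP=> sq_s.
pose B := [set a' in A j | h a'].
pose F a' := spart (b * a').
have KA l e : e \in A l -> e \in K by apply: (subsetP (sAK l)).
have F_B : F @: B \subset sq.
  apply/subsetP=> _ /imsetP[a' /setIdP[Aa' ha'] ->].
  have [Sa' [c' Ec' def_c']] := spartP (groupM (KA _ _ Ab) (KA _ _ Aa')).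
  exact: (spart_sq (mem_transv Ab) hb (mem_transv Aa') ha' Sa' Ec' def_c').
have injF : {in A j &, injective F} := spart_inj neq_ij Ab ntb.
have sBA : B \subset A j by apply/subsetP=> a'; rewrite inE => /andP[].
(* Left translation by [a] maps [A j :\: B] into [B], as a product of two inverting elements
   centralises. *)
have oB : #|A j| <= 2 * #|B|.
  rewrite -(cardsID B (A j)) (setIidPr sBA) mul2n -addnn leq_add2l.
  rewrite -(card_imset _ (mulgI a)); apply/subset_leq_card/subsetP=> _ /imsetP[a' + ->].
  rewrite !inE => /andP[nB Aa']; rewrite groupM //= hNM ?(KA j) //.
  by move: nB; rewrite Aa'.
have osq : (2 * #|sq|)%N = t.
  rewrite -orderE orderXdiv ox; last by apply: dvdn_trans t4.
  by rewrite mulnC divnK //; apply: dvdn_trans t4.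
have def_sq : F @: B = sq.
  apply/eqP; rewrite eqEcard F_B card_in_imset; last first.
    by move=> a1 a2 /(subsetP sBA) Aa1 /(subsetP sBA) Aa2; apply: injF.
  by rewrite -(leq_pmul2l (ltn0Sn 1)) osq -(oA j).
have: F a \in F @: B by rewrite def_sq /F eq_ba spartE.
case/imsetP=> a' /setIdP[Aa' ha'] eq_F.
by rewrite (injF a a' Aa Aa' eq_F) ha' in nha.
Qed.

(* Write e0 w = s1 c1 with h w and h b. The S-parts of e0 w, of (b e0) w and of
   b c1 are all non-squares, but up to fourth powers the second is the product of
   the other two. *)
Lemma twisted_absurd : False.
Proof.
have KA l e : e \in A l -> e \in K by apply: (subsetP (sAK l)).
(* The elements of A l satisfying [h] form a subgroup of index at most 2, and t >= 4. *)
have ex_h l : exists e, [/\ e \in A l, e != 1 & h e].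
  pose B := [set e in A l | h e].
  have: 1 < #|B|.
    have [BA | ] := boolP (A l \subset B).
      by apply: leq_trans (subset_leq_card BA); rewrite oA.
    case/subsetPn=> a Aa; rewrite inE Aa /= => nha.
    rewrite ltnNge; apply/negP=> oB1.
    have : #|A l| <= 2.
      have sBA : B \subset A l by apply/subsetP=> a'; rewrite inE => /andP[].
      rewrite -(cardsID B (A l)) (setIidPr sBA) -[2]/(1 + 1)%N; apply: leq_add => //.
      apply: leq_trans oB1.
      rewrite -(card_imset _ (mulgI a)); apply/subset_leq_card/subsetP=> _ /imsetP[a' + ->].
      rewrite !inE => /andP[nB Aa']; rewrite groupM //= hNM ?(KA l) //.
      by move: nB; rewrite Aa'.
    by rewrite oA; move: (dvdn_leq (ltnW t_gt1) t4); case: (t) => [|[|[|]]].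
  have B1 : 1 \in B by rewrite inE group1 hS.
  rewrite (cardsD1 1) B1 ltnS card_gt0 => /set0Pn[e]; rewrite !inE.
  by case/and3P=> nte Ae he; exists e.
have /transvP[i Ae0] := Ee0.
have [j neq_ji] := exists_other i; have neq_ij : i != j by rewrite eq_sym.
have [b [Ab ntb hb]] := ex_h i; have [w [Aw ntw hw]] := ex_h j.
have [Kb Kw] := (KA _ _ Ab, KA _ _ Aw).
(* [spart_nonsq] speaks of w * b'. The S-part of b' * w differs from it by a commutator, trivial
   modulo [x ^+ 4] because w is central there. *)
have row b' s c : b' \in A i -> ~~ h b' -> s \in S -> c \in transv ->
    b' * w = s * c -> s \notin sq.
  move=> Ab' nhb' Ss Ec eq_bw; have Kb' := KA _ _ Ab'.
  have [s' [c' [Ss' Ec' eq_wb _]]] := decompE (groupM Kw Kb').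
  have s'nsq := spart_nonsq neq_ji Aw ntw hw Ab' nhb' Ss' Ec' eq_wb.
  pose n := (b' * w) * (w * b')^-1.
  have fn : f n = 1.
    rewrite /n fM ?groupV ?groupM // morphV ?(subsetP nNK) ?groupM //=.
    by rewrite !fM // (commE (mem_transv Aw) hw Kb') mulgV.
  have Sn : n \in S.
    have -> : n = [~ (b')^-1, w^-1] by rewrite /n commgEl /conjg !invgK invMg !mulgA.
    by rewrite der_sub ?groupV.
  have eq_s : s = n * s'.
    have := decomp_inj Ss (groupM Sn Ss') Ec Ec' _; case=> //.
    by rewrite -mulgA -eq_wb -eq_bw /n mulgKV.
  have cS : n * s' = s' * n by apply: (centsP (cyclic_abelian cycS)).
  by rewrite eq_s cS sqN.
have [s1 [c1 [Ss1 Ec1 eq1 hc1]]] := decompE (groupM (KA _ _ Ae0) Kw).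
have nhc1 : ~~ h c1 by rewrite -hc1 (hMr (KA _ _ Ae0) Kw hw).
have s1_nsq := row _ _ _ Ae0 nhe0 Ss1 Ec1 eq1.
case/transvP: (Ec1) => k Ac1.
(* Distinct components are needed for [spart_nonsq] on b * c1; with i = k, w would lie in S * A
   i. *)
have neq_ik : i != k.
  apply: contra_neq ntw => def_k; rewrite -def_k in Ac1.
  have def_w : w = s1 ^ e0 * (e0^-1 * c1).
    rewrite -[w in LHS](mulKg e0) eq1 !mulgA; congr (_ * _).
    by rewrite conjgE mulgA mulgK.
  apply: (tangencyl neq_ji Aw _ _ def_w); first by rewrite groupM ?groupV.
  by rewrite memJ_norm // (subsetP nSKs) // (KA i).
have [s2 [d [Ss2 Ed eq2 _]]] := decompE (groupM Kb (KA _ _ Ac1)).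
have s2_nsq := spart_nonsq neq_ik Ab ntb hb Ac1 nhc1 Ss2 Ed eq2.
pose s1' := s1 ^ b^-1.
(* Moving s1 to the left past b shows the S-part to be s1' * s2, a product of two non-squares, hence
   a square. *)
have eq3 : b * e0 * w = (s1' * s2) * d.
  by rewrite -(mulgA b) eq1 -(mulgA s1') -eq2 !mulgA /s1' [b * s1]conjgCV.
have Ss1' : s1' \in S by rewrite memJ_norm ?groupV ?(subsetP nSKs).
have := row _ _ _ (groupM Ab Ae0) _ (groupM Ss1' Ss2) Ed eq3.
rewrite hM ?(KA i) // => /(_ nhe0).
suff s1'_nsq : s1' \notin sq by rewrite nonsqM // s2_nsq.
have nsq : K \subset 'N(sq).
  have sSq : <[x ^+ 2]> \subset S by rewrite cycle_subG groupX.
  by apply: char_norm_trans (nSKs); rewrite sub_cyclic_char.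
by rewrite memJ_norm ?groupV ?(subsetP nsq).
Qed.

End TwistedCase.

(** * All of K centralises S modulo x^4 *)

Section UntwistedCase.

Hypothesis hK : forall g, g \in K -> h g.

Let conjx g : g \in K -> exists k, x ^ g = x ^+ (1 + 4 * k).
Proof.
move=> Kg; have fix_x : f (x^-1 * x ^ g) = 1.
  rewrite fM ?groupV ?groupJ ?(SK Sx) // morphV ?morphJ ?(subsetP nNK) ?(SK Sx) //=.
  by rewrite fx_conj // hK // expg1 mulVg.
have: x^-1 * x ^ g \in N.
  by rewrite coset_idr // (subsetP nNK) // groupM ?groupV ?groupJ ?(SK Sx).
case/cycleP=> k def_xg; exists k.
by rewrite expgD expg1 expgM -def_xg mulKVg.
Qed.

(** Squaring b * a = x * c gives b * b ^ a = x * x ^ c = x ^+ n with n = 2 + 4k. Since b ^ a = b * x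
    ^+ n squares to 1 and x ^ b = x ^+ (1 + 4m), the power of x with exponent n(2 + 4m) is trivial.
    This exponent is 4 times an odd number, and t is a power of 2. *)
Lemma untwisted_order : t = 4.
Proof.
have [i [j [b [a [c [_ Ab Aa Ec [eq_ba _]]]]]]] := triple_of_generator Sx.
have [[Eb Ea] Kc] := ((mem_transv Ab, mem_transv Aa), EK Ec).
have [Kb Ka] := (EK Eb, EK Ea).
have [k xc] := conjx Kc; have [m xb] := conjx Kb.
have [n def_n] : exists n, n = (2 + 4 * k)%N by eexists.
have w_def : b * b ^ a = x ^+ n.
  have -> : b * b ^ a = x * x ^ c.
    rewrite !conjgE (invE Ea) (invE Ec) !mulgA eq_ba -!mulgA; congr (_ * _).
    by rewrite eq_ba.
  by rewrite xc -expgS def_n addnA.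
have ba2 : b ^ a * b ^ a = 1 by rewrite -conjMg inv2 // conj1g.
have def_ba : b ^ a = b * x ^+ n by rewrite -w_def mulgA inv2 // mul1g.
have : x ^+ (4 * ((1 + 2 * k) * (1 + 2 * m))) = 1.
  have -> : (4 * ((1 + 2 * k) * (1 + 2 * m)) = (1 + 4 * m) * n + n)%N.
    by rewrite def_n; ring.
  rewrite expgD expgM -xb -conjXg conjgE (invE Eb) -!mulgA.
  by rewrite mulgA -def_ba ba2.
move/eqP; rewrite -order_dvdn ox => t_dv.
have t_dv4 : t %| 4.
  have odd_c : odd ((1 + 2 * k) * (1 + 2 * m))%N by rewrite !mul2n oddM /= !odd_double.
  have [e def_t] := p_natP t_pnat; move: t_dv; rewrite mulnC Gauss_dvdr //.
  by rewrite def_t p2 coprimeXl ?coprime2n.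
by apply/eqP; rewrite eqn_dvd t_dv4.
Qed.

Let x4 : x ^+ 4 = 1. Proof. by rewrite -untwisted_order -ox expg_order. Qed.

Let centS s g : s \in S -> g \in K -> s * g = g * s.
Proof.
move=> Ss Kg; suff: commute g s by [].
move: Ss; rewrite defS => /cycleP[n ->]; apply: commuteX; apply/commute_sym/commgP.
apply/conjg_fixP; have [k ->] := conjx Kg.
by rewrite expgD expg1 expgM x4 expg1n mulg1.
Qed.

(* Kept abstract: rewriting with [mulgA] would see through [x ^+ 2]. *)
Variable z : gT.
Hypothesis def_z : z = x ^+ 2.

Let Sz : z \in S. Proof. by rewrite def_z groupX. Qed.
Let zz : z * z = 1. Proof. by rewrite def_z -expgD. Qed.
Let sq_z : z \in sq. Proof. by rewrite def_z cycle_id. Qed.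

Let z_neq1 : z != 1.
Proof. by rewrite def_z -order_dvdn ox untwisted_order. Qed.

Let sq_1z s : s \in sq -> s = 1 \/ s = z.
Proof.
case/cycleP=> k ->; rewrite -(odd_double_half k) expgD -mul2n.
have z2 : (x ^+ 2) ^+ 2 = 1 by rewrite -[RHS]zz def_z.
rewrite def_z [_ ^+ (2 * _)]expgM z2 expg1n mulg1.
by case: odd; [right | left].
Qed.

Let sqr1 s : s \in S -> s * s = 1 -> s = 1 \/ s = z.
Proof. by move=> Ss ss1; apply: sq_1z; rewrite -sq_sqr // -fM ?SK // ss1 morph1. Qed.

Let sqrE u v s c : u \in transv -> v \in transv -> s \in S -> c \in transv ->
  u * v = s * c -> u * v * (u * v) = s * s.
Proof.
move=> Eu Ev Ss Ec ->; rewrite -mulgA (mulgA c) -(centS Ss (EK Ec)) -(mulgA s c).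
by rewrite (inv2 Ec) mulg1.
Qed.

(** The witness is the square of u * v, which equals s * s for the S-part s and is thus 1 or z;
    since u and v square to 1, it is also the commutator factor. *)
Let commE u v : u \in transv -> v \in transv ->
  exists w, [/\ w = 1 \/ w = z, w * w = 1 & u * v = w * (v * u)].
Proof.
move=> Eu Ev; have [s [c [Ss Ec eq_uv _]]] := decompE (groupM (EK Eu) (EK Ev)).
have ww : s * s * (s * s) = 1.
  move: (Ss); rewrite defS => /cycleP[k ->].
  by rewrite -!expgD -[(k + k + _)%N]/(_ + _)%N addnn addnn -!muln2 -mulnA mulnC expgM x4 expg1n.
exists (s * s); split=> //; first by apply: sqr1; rewrite ?groupM.
rewrite -(sqrE Eu Ev Ss Ec eq_uv) -!mulgA (mulgA v v) inv2 // mul1g.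
by rewrite inv2 // mulg1.
Qed.

(** Write s * d = b * a for a nontrivial d in A l. If s is a non-square for both d1 and d2, then for
    d1 * d2 it is the product of two non-squares, up to a commutator in {1, z}, hence a square. A
    square is 1 or z, and 1 is excluded by [triangle]. *)
Let diag_exists i j l : i != j -> i != l -> j != l ->
  exists b a c, [/\ b \in A i, a \in A j, c \in A l & b * a = z * c].
Proof.
move=> neq_ij neq_il neq_jl.
have KA k e : e \in A k -> e \in K by apply: (subsetP (sAK k)).
have fin s d b a : s \in sq -> d \in A l -> d != 1 -> b \in A i -> a \in A j ->
    s * d = b * a ->
  exists b a c, [/\ b \in A i, a \in A j, c \in A l & b * a = z * c].
  move=> sq_s Ad ntd Ab Aa; case: (sq_1z sq_s) => ->.
    rewrite mul1g => /esym eq_ba; case/eqP: ntd.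
    exact: (triangle neq_ij neq_il neq_jl Ab Aa Ad eq_ba).
  by move=> eq_ba; exists b, a, d; rewrite -eq_ba.
have /trivgPn[d1 Ad1 nt1] : A l :!=: 1 by rewrite -cardG_gt1 oA.
have [d2 Ad2] : exists2 d2, d2 \in A l & d2 \notin [set 1; d1].
  apply/subsetPn/negP=> /subset_leq_card.
  by rewrite oA untwisted_order cards2; case: (1 != d1).
rewrite !inE negb_or => /andP[nt2 neq_d].
have [s1 [b1 [a1 [Ss1 Ab1 Aa1 eq1]]]] := decomp3 neq_ij (KA _ _ Ad1).
have [s2 [b2 [a2 [Ss2 Ab2 Aa2 eq2]]]] := decomp3 neq_ij (KA _ _ Ad2).
have [sq1 | nsq1] := boolP (s1 \in sq); first exact: fin sq1 Ad1 nt1 Ab1 Aa1 eq1.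
have [sq2 | nsq2] := boolP (s2 \in sq); first exact: fin sq2 Ad2 nt2 Ab2 Aa2 eq2.
have [w [w1z ww eq_w]] := commE (mem_transv Aa1) (mem_transv Ab2).
apply: (fin (w * (s1 * s2)) (d1 * d2) (b1 * b2) (a1 * a2)).
- rewrite groupMl ?nonsqM //.
  by case: w1z => ->; rewrite ?group1 ?sq_z.
- exact: groupM.
- by rewrite -eq_invg_mul (invE (mem_transv Ad1)) eq_sym.
- exact: groupM.
- exact: groupM.
have Sw : w \in S by case: w1z => ->.
have [[Kb1 Ka1] [Kb2 Ka2]] := ((KA _ _ Ab1, KA _ _ Aa1), (KA _ _ Ab2, KA _ _ Aa2)).
have eq12 : s1 * s2 * (d1 * d2) = b1 * a1 * (b2 * a2).
  rewrite -eq1 -eq2 -!mulgA; congr (_ * _).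
  by rewrite !mulgA (centS Ss2 (KA _ _ Ad1)).
rewrite -mulgA eq12 -!mulgA (mulgA a1) eq_w -!mulgA (mulgA b1 w).
by rewrite -(centS Sw Kb1) !mulgA ww mul1g.
Qed.

Let diag_nt i j b a c : i != j -> b \in A i -> a \in A j -> c \in transv ->
  b * a = z * c -> [/\ b != 1, a != 1 & c != 1].
Proof.
move=> neq_ij Ab Aa Ec eq_ba.
have nt e e' : e \in transv -> e' \in transv -> e = z * e' -> False.
  move=> Ee Ee' eq_e; case/eqP: z_neq1; symmetry.
  by have [] := decomp_inj (group1 S) Sz Ee Ee' (etrans (mul1g e) eq_e).
have ntb : b != 1.
  apply/eqP=> b1; apply: (nt a c) => //; first exact: mem_transv Aa.
  by rewrite -eq_ba b1 mul1g.
split=> //.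
  apply/eqP=> a1; apply: (nt b c) => //; first exact: mem_transv Ab.
  by rewrite -eq_ba a1 mulg1.
apply: contra_neq ntb => c1; apply: (tangencyl neq_ij Ab (groupVr Aa) Sz).
by rewrite -[z]mulg1 -c1 -eq_ba mulgK.
Qed.

(** With a1 = a2 the quotient c1 * c2^-1 equals b1 * b2^-1, an element of A i, against [no_tri] for
    A l and A m. *)
Let diag_neq i j l m b1 a1 c1 b2 a2 c2 : i != j -> l != m ->
    b1 \in A i -> a1 \in A j -> c1 \in A l -> b1 * a1 = z * c1 ->
    b2 \in A i -> a2 \in A j -> c2 \in A m -> b2 * a2 = z * c2 ->
  a1 != a2.
Proof.
move=> neq_ij neq_lm Ab1 Aa1 Ac1 eq1 Ab2 Aa2 Ac2 eq2; apply/eqP=> eq_a.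
have [_ _ ntc1] := diag_nt neq_ij Ab1 Aa1 (mem_transv Ac1) eq1.
have [_ _ ntc2] := diag_nt neq_ij Ab2 Aa2 (mem_transv Ac2) eq2.
have Abb : b1 * b2^-1 \in A i by rewrite groupM ?groupV.
have eq_c : c1 * c2^-1 = b1 * b2^-1.
  apply: (mulgI z); rewrite (centS Sz (subsetP (sAK i) _ Abb)) mulgA -eq1.
  by rewrite -(mulKg b2 a1) eq_a eq2 !mulgA mulgK.
have [|c1_1|/eqP] := no_tri neq_lm Ac1 (groupVr Ac2).
- by rewrite eq_c (mem_transv Abb).
- by rewrite c1_1 eqxx in ntc1.
by rewrite invg_eq1 (negPf ntc2).
Qed.

(** If a1 and b2 commuted, the S-part s of b2 * a1 would square to 1. But s = 1 contradicts
    [no_tri], and s = z contradicts [row_inj], since b2 * a2 has S-part z too and a1 != a2. *)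
Let diag_comm i j l m b1 a1 c1 b2 a2 c2 : i != j -> l != m ->
    b1 \in A i -> a1 \in A j -> c1 \in A l -> b1 * a1 = z * c1 ->
    b2 \in A i -> a2 \in A j -> c2 \in A m -> b2 * a2 = z * c2 ->
  a1 * b2 = z * (b2 * a1).
Proof.
move=> neq_ij neq_lm Ab1 Aa1 Ac1 eq1 Ab2 Aa2 Ac2 eq2.
have neq_a := diag_neq neq_ij neq_lm Ab1 Aa1 Ac1 eq1 Ab2 Aa2 Ac2 eq2.
have [_ /negPf nta1 _] := diag_nt neq_ij Ab1 Aa1 (mem_transv Ac1) eq1.
have [ntb2 _ _] := diag_nt neq_ij Ab2 Aa2 (mem_transv Ac2) eq2.
have [Ea1 Eb2] := (mem_transv Aa1, mem_transv Ab2).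
have [w [[-> _ | -> //] eq_w]] := commE Ea1 Eb2; rewrite mul1g in eq_w.
have [s [c [Ss Ec eq_ba _]]] := decompE (groupM (EK Eb2) (EK Ea1)).
have := sqrE Eb2 Ea1 Ss Ec eq_ba; rewrite -{2}eq_w -mulgA (mulgA a1) (inv2 Ea1) mul1g (inv2 Eb2).
case/esym/(sqr1 Ss)=> def_s; rewrite def_s in eq_ba.
  rewrite mul1g in eq_ba; have [|b1' | a1'] := no_tri neq_ij Ab2 Aa1; first by rewrite eq_ba.
    by rewrite b1' eqxx in ntb2.
  by rewrite a1' eqxx in nta1.
by case/eqP: neq_a; apply: (row_inj neq_ij Ab2 ntb2 Aa1 Aa2 Sz Ec (mem_transv Ac2) eq_ba eq2).
Qed.

(** Multiply two relations b * a = z * c with c in A l and in A m: by [diag_comm], c1 * c2 is z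
    times the product of b1 * b2 and a1 * a2. These two commute, so their product has S-part 1 or z;
    the first contradicts [no_tri] for i, j and the second for l, m. *)
Lemma untwisted_absurd : False.
Proof.
have [i _] : exists i, i \in [set: I] by apply/card_gt0P; rewrite cardsT oI.
have [j neq_ji] := exists_other i; have neq_ij : i != j by rewrite eq_sym.
have out (B : {set I}) : #|B| <= 3 -> exists l, l \notin B.
  move=> oB; apply/existsP; apply: contraLR oB => /existsPn allB.
  have -> : B = setT by apply/setP=> l; rewrite inE; apply/negPn/allB.
  by rewrite cardsT oI untwisted_order.
have [l] : exists l, l \notin [set i; j].
  by apply: out; rewrite cards2; case: (i != j).
rewrite !inE negb_or => /andP[neq_li neq_lj].
have [m] : exists m, m \notin l |: [set i; j].
  by apply: out; rewrite cardsU1 cards2; case: (l \notin _); case: (i != j).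
rewrite !inE !negb_or => /and3P[neq_ml neq_mi neq_mj].
have [b1 [a1 [c1 [Ab1 Aa1 Ac1 eq1]]]] :
    exists b a c, [/\ b \in A i, a \in A j, c \in A l & b * a = z * c].
  by apply: diag_exists; rewrite // eq_sym.
have [b2 [a2 [c2 [Ab2 Aa2 Ac2 eq2]]]] :
    exists b a c, [/\ b \in A i, a \in A j, c \in A m & b * a = z * c].
  by apply: diag_exists; rewrite // eq_sym.
have neq_lm : l != m by rewrite eq_sym.
have [_ _ ntc1] := diag_nt neq_ij Ab1 Aa1 (mem_transv Ac1) eq1.
have [_ _ ntc2] := diag_nt neq_ij Ab2 Aa2 (mem_transv Ac2) eq2.
have [ntb2 _ _] := diag_nt neq_ij Ab2 Aa2 (mem_transv Ac2) eq2.
have neq_a := diag_neq neq_ij neq_lm Ab1 Aa1 Ac1 eq1 Ab2 Aa2 Ac2 eq2.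
have eq12 := diag_comm neq_ij neq_lm Ab1 Aa1 Ac1 eq1 Ab2 Aa2 Ac2 eq2.
have eq21 := diag_comm neq_ij neq_ml Ab2 Aa2 Ac2 eq2 Ab1 Aa1 Ac1 eq1.
have neq_b : b1 != b2.
  apply: contra_neq neq_a => eq_b; rewrite eq_b in eq1.
  exact: (row_inj neq_ij Ab2 ntb2 Aa1 Aa2 Sz (mem_transv Ac1) (mem_transv Ac2) eq1 eq2).
have KA k e : e \in A k -> e \in K by apply: (subsetP (sAK k)).
have [[Kb1 Ka1] [Kb2 Ka2]] := ((KA _ _ Ab1, KA _ _ Aa1), (KA _ _ Ab2, KA _ _ Aa2)).
have Ab3 : b1 * b2 \in A i by rewrite groupM.
have Aa3 : a1 * a2 \in A j by rewrite groupM.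
have ntb3 : b1 * b2 != 1 by rewrite -eq_invg_mul (invE (mem_transv Ab1)).
have nta3 : a1 * a2 != 1 by rewrite -eq_invg_mul (invE (mem_transv Aa1)).
have zV u : z * (z * u) = u by rewrite mulgA zz mul1g.
have c12 : c1 * c2 = z * (b1 * b2 * (a1 * a2)).
  have -> : c1 = z * (b1 * a1) by rewrite eq1 zV.
  have -> : c2 = z * (b2 * a2) by rewrite eq2 zV.
  rewrite -(mulgA z) (mulgA (b1 * a1) z) -(centS Sz (groupM Kb1 Ka1)) -!mulgA zV.
  by rewrite (mulgA a1) eq12 -!mulgA (mulgA b1 z) -(centS Sz Kb1) -!mulgA.
(* The two mixed pairs contribute a factor z each, and these cancel. *)
have comm3 : a1 * a2 * (b1 * b2) = b1 * b2 * (a1 * a2).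
  have cba b a c : b \in transv -> a \in transv -> c \in transv ->
      b * a = z * c -> a * b = b * a.
    move=> Eb Ea Ec eq_ba; symmetry; apply: invol_comm; try exact: inv2.
    by rewrite (sqrE Eb Ea Sz Ec eq_ba).
  have c1' := cba _ _ _ (mem_transv Ab1) (mem_transv Aa1) (mem_transv Ac1) eq1.
  have c2' := cba _ _ _ (mem_transv Ab2) (mem_transv Aa2) (mem_transv Ac2) eq2.
  rewrite -mulgA (mulgA a2) eq21 -!mulgA (mulgA a1 z) -(centS Sz Ka1) -!mulgA.
  rewrite c2' (mulgA a1) c1' -mulgA (mulgA a1) eq12 -!mulgA.
  by rewrite (mulgA b1 z) -(centS Sz Kb1) -!mulgA zV.
have [s [c [Ss Ec eq3 _]]] := decompE (groupM (groupM Kb1 Kb2) (groupM Ka1 Ka2)).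
have := sqrE (mem_transv Ab3) (mem_transv Aa3) Ss Ec eq3.
rewrite -{2}comm3 -(mulgA (b1 * b2)) (mulgA (a1 * a2)) (inv2 (mem_transv Aa3)) mul1g.
rewrite (inv2 (mem_transv Ab3)) => /esym/(sqr1 Ss) [] def_s; rewrite def_s in eq3.
  rewrite mul1g in eq3; have [|/eqP|/eqP] := no_tri neq_ij Ab3 Aa3; first by rewrite eq3.
    by rewrite (negPf ntb3).
  by rewrite (negPf nta3).
rewrite eq3 zV // in c12.
have [|/eqP|/eqP] := no_tri neq_lm Ac1 Ac2; first by rewrite c12.
  by rewrite (negPf ntc1).
by rewrite (negPf ntc2).
Qed.

End UntwistedCase.

Lemma four_dvd_absurd : False.
Proof.
case: (pickP (fun e => (e \in transv) && ~~ h e)) => [e /andP[Ee nhe] | all_h].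
  exact: (twisted_absurd Ee nhe).
apply: (untwisted_absurd _ (erefl (x ^+ 2))) => g Kg; have [s [c [Ss Ec _ ->]]] := decompE Kg.
by have := all_h c; rewrite Ec /= => /negbFE.
Qed.

End Two.

Lemma t_eq_pdiv : t = p.
Proof.
have [| p_even] := boolP (odd p); first exact: odd_prime.
have p2 : p = 2 by case: (even_prime p_pr) => // podd; rewrite podd in p_even.
have /cyclicP[x defS] := cycS.
have [n def_t] := p_natP t_pnat.
case: n def_t => [t1 | [|n] def_t]; first by have := t_gt1; rewrite t1.
  by rewrite def_t expn1.
case: (@four_dvd_absurd x) => //.
by rewrite def_t p2 (@dvdn_exp2l 2 2).
Qed.

Let t_pr : prime t. Proof. by rewrite t_eq_pdiv. Qed.

(** A nontrivial normal subgroup of a nilpotent group meets the centre, and S has prime order. *)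
Lemma cent_S s g : s \in S -> g \in K -> commute s g.
Proof.
have : S \subset 'Z(K).
  apply: prime_meetG; first by rewrite oS.
  apply: meet_center_nil; rewrite ?nSK -?cardG_gt1 ?oS //.
  apply: (pgroup_nil (p := t)); rewrite /pgroup oK pnatX pnat_id //.
by move/subsetP=> sSZ /sSZ/setIP[_ /centP]; apply.
Qed.

(** * The S-part of b^i a^j as a function of i and j *)

Section Coordinates.

Local Notation F := 'F_t.

Variables (x a b : gT) (i1 i2 : I) (kappa : F).
Hypothesis Sx : x \in S.
Hypothesis ntx : x != 1.
Hypothesis neq_i : i1 != i2.
Hypothesis Ab : b \in A i1.
Hypothesis ntb : b != 1.
Hypothesis Aa : a \in A i2.
Hypothesis nta : a != 1.
Hypothesis comm_ab : [~ a, b] = x ^+ kappa.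

Let AX i c : c \in A i -> c ^+ t = 1.
Proof. by move=> Ac; rewrite -(oA i); apply: expg_cardG. Qed.
Let Kb : b \in K. Proof. exact: (subsetP (sAK i1)). Qed.
Let Ka : a \in K. Proof. exact: (subsetP (sAK i2)). Qed.
Let bt : b ^+ t = 1. Proof. exact: AX Ab. Qed.
Let at_ : a ^+ t = 1. Proof. exact: AX Aa. Qed.
Let xt : x ^+ t = 1. Proof. by rewrite -oS expg_cardG. Qed.

Lemma prime_cycle (H : {group gT}) c : #|H| = t -> c \in H -> c != 1 -> H = <[c]> :> {set gT}.
Proof.
move=> oH Hc ntc; apply/esym/eqP; rewrite eqEcard cycle_subG Hc oH -orderE.
have ct : c ^+ t = 1 by rewrite -oH expg_cardG.
by rewrite (nt_prime_order t_pr ct ntc) leqnn.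
Qed.

Let cx k g : g \in K -> commute (x ^+ k) g.
Proof. by move=> Kg; apply: cent_S; rewrite ?groupX. Qed.

Lemma mem_S_exp s : s \in S -> exists k : F, s = x ^+ k.
Proof.
rewrite (prime_cycle oS Sx ntx) => /cycleP[k ->].
by exists (k%:R%R); rewrite expg_natF.
Qed.

Lemma x_inj (k l : F) : x ^+ k = x ^+ l -> k = l.
Proof.
move/eqP; rewrite eq_mulgV1 -expgF_N // -expgF_D // expgF_eq1 //.
by rewrite subr_eq0 => /eqP.
Qed.

Lemma word_decomp (i j : F) :
  exists k : F, (x ^+ k)^-1 * (b ^+ i * a ^+ j) \in transv.
Proof.
have [s [c [Ss Ec ->]]] := decomp (groupM (groupX i Kb) (groupX j Ka)).
by have [k ->] := mem_S_exp Ss; exists k; rewrite mulKg.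
Qed.

(* x ^+ shift i j is the S-part of b ^+ i * a ^+ j. *)
Definition shift (i j : F) : F :=
  odflt 0%R [pick k : F | (x ^+ k)^-1 * (b ^+ i * a ^+ j) \in transv].

Lemma shiftP (i j : F) : exists2 c, c \in transv & b ^+ i * a ^+ j = x ^+ shift i j * c.
Proof.
rewrite /shift; case: pickP => [k Ek | no_k]; last first.
  by have [k] := word_decomp i j; rewrite no_k.
by exists ((x ^+ k)^-1 * (b ^+ i * a ^+ j)); rewrite ?mulKVg.
Qed.

Lemma shiftE (i j k : F) c : c \in transv -> b ^+ i * a ^+ j = x ^+ k * c -> shift i j = k.
Proof.
move=> Ec eq_c; have [c' Ec' eq_c'] := shiftP i j; rewrite eq_c' in eq_c.
by have [/x_inj] := decomp_inj (groupX _ Sx) (groupX _ Sx) Ec' Ec eq_c.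
Qed.

Lemma shift_i0 (i : F) : shift i 0%R = 0%R.
Proof.
apply: (@shiftE _ _ _ (b ^+ i)); last by rewrite mulg1 mul1g.
by rewrite (@mem_transv i1) ?groupX.
Qed.

Lemma shift_0j (j : F) : shift 0%R j = 0%R.
Proof.
by apply: (@shiftE _ _ _ (a ^+ j)); rewrite // (@mem_transv i2) ?groupX.
Qed.

Lemma shift_inj (i : F) : i != 0%R -> injective (shift i).
Proof.
move=> nz_i j j' eq_s; have [c Ec eq_c] := shiftP i j.
have [c' Ec' eq_c'] := shiftP i j'; rewrite -eq_s in eq_c'.
have ntbi : b ^+ i != 1 by rewrite expgF_eq1.
have := row_inj neq_i (groupX i Ab) ntbi (groupX j Aa) (groupX j' Aa)
  (groupX _ Sx) Ec Ec' eq_c eq_c'.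
move/eqP; rewrite eq_mulgV1 -expgF_N // -expgF_D // expgF_eq1 // subr_eq0.
by move/eqP.
Qed.

Lemma shift_neq0 (i j : F) : i != 0%R -> j != 0%R -> shift i j != 0%R.
Proof. by move=> nz_i; rewrite -{2}(shift_i0 i) (inj_eq (shift_inj nz_i)). Qed.

Lemma comm_pow (i j : F) : [~ a ^+ j, b ^+ i] = x ^+ (kappa * (j * i))%R.
Proof.
rewrite commXXg ?comm_ab; try exact/commute_sym/cx.
by rewrite expgF_X // natrM !natr_Zp mulrC.
Qed.

(** Raise b^i a^j = x^(shift i j) c to the m-th power: c^m stays in its component, and since S is
    central the class-two power formula yields the commutator term. *)
Lemma shift_mulr m (i j : F) :
  shift (m%:R * i)%R (m%:R * j)%R = (m%:R * shift i j - kappa * (j * i) * ('C(m, 2))%:R)%R.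
Proof.
have [c Ec eq_c] := shiftP i j.
have [l Al] := transvP _ Ec.
apply: (@shiftE _ _ _ (c ^+ m)); first by rewrite (@mem_transv l) ?groupX.
have := congr1 (fun g => g ^+ m) eq_c.
rewrite expMg_Rmul ?comm_pow; try exact/commute_sym/cx/groupX.
rewrite expgMn; last by apply: cx; apply: (subsetP transv_sub).
rewrite !expgF_X // => /(canRL (mulgK _)) ->.
rewrite -mulgA -expgF_N // -cx ?groupX ?(subsetP transv_sub) //.
by rewrite mulgA -expgF_D // (mulrC (kappa * _)%R).
Qed.

(** When [kappa] vanishes, a and b commute and may exchange roles in [row_inj]. *)
Lemma shift_inv (j : F) : kappa = 0%R -> j != 0%R -> injective (shift^~ j).
Proof.
move=> kappa0 nz_j i i' /= eq_s.
have caj (k : F) : a ^+ j * b ^+ k = b ^+ k * a ^+ j.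
  by apply/commgP; rewrite comm_pow kappa0 mul0r.
have [c Ec eq_c] := shiftP i j.
have [c' Ec' eq_c'] := shiftP i' j; rewrite -eq_s in eq_c'.
rewrite -caj in eq_c; rewrite -caj in eq_c'.
have ntaj : a ^+ j != 1 by rewrite expgF_eq1.
have neq_i' : i2 != i1 by rewrite eq_sym.
have := row_inj neq_i' (groupX j Aa) ntaj (groupX i Ab) (groupX i' Ab)
  (groupX _ Sx) Ec Ec' eq_c eq_c'.
move/eqP; rewrite eq_mulgV1 -expgF_N // -expgF_D // expgF_eq1 // subr_eq0.
by move/eqP.
Qed.

Local Open Scope ring_scope.

Lemma shift_scale (m r : F) :
  shift m (m * r) * 2 = m * (shift 1 r * 2 - kappa * r * (m - 1)).
Proof.
have := shift_mulr m 1 r; rewrite natr_Zp !mulr1 => ->.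
have /(congr1 (fun n => n%:R : F)) := bin2_double m.
rewrite natrD !natrM natr_Zp => /(canRL (addrK _)) bin_m.
by rewrite mulrBl -!mulrA bin_m; ring.
Qed.

Lemma shift_even : (2 : F) = 0 -> exists lam : F,
  [/\ lam != 0, kappa = - (lam * 2) & forall i j, shift i j = lam * i * j].
Proof.
move=> F2; have t2 : t = 2.
  by apply/eqP; rewrite -dvdn_prime2 // (dvdn_pcharf (pchar_Fp t_pr)) F2.
have F01 (i : F) : i = 0 \/ i = 1.
  have : (i < 2)%N by rewrite -[X in (_ < X)%N]t2 -{2}(Fp_cast t_pr).
  by rewrite -[i in i = 0 \/ _]natr_Zp -[i in _ \/ i = _]natr_Zp; case: (i : nat) => [|[|]]; auto.
exists (shift 1 1); split.
- by rewrite shift_neq0 ?oner_eq0.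
- have := shift_mulr 2 1 1; rewrite F2 !mul0r shift_i0 !mulr1 mulr0 oppr0 sub0r.
  by move/esym/eqP; rewrite oppr_eq0 => /eqP.
move=> i j; case: (F01 i) (F01 j) => -> [] ->;
  by rewrite ?shift_i0 ?shift_0j ?mulr0 ?mul0r ?mulr1.
Qed.

(** For r != 0 choose m with kappa r (m - 1) = 2 shift 1 r. By [shift_scale], shift m (m r) = 0,
    whereas [shift] does not vanish on nonzero arguments; so m = 0, which says 2 shift 1 r = - kappa
    r. *)
Lemma shift_odd : (2 : F) != 0 -> kappa != 0 -> exists lam : F,
  [/\ lam != 0, kappa = - (lam * 2) & forall i j, shift i j = lam * i * j].
Proof.
move=> F2 nzk; pose lam := - kappa / 2.
have kappaE : kappa = - (lam * 2) by rewrite /lam mulfVK // opprK.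
have f1 r : shift 1 r = lam * r.
  have [-> | nz_r] := eqVneq r 0; first by rewrite shift_i0 mulr0.
  pose m := 1 + shift 1 r * 2 / (kappa * r).
  have nzkr : kappa * r != 0 by rewrite mulf_neq0.
  have m1 : kappa * r * (m - 1) = shift 1 r * 2.
    by rewrite /m addrAC subrr add0r mulrC divfK.
  have [m0 | nz_m] := eqVneq m 0; last first.
    have := shift_neq0 nz_m (mulf_neq0 nz_m nz_r).
    have := shift_scale m r; rewrite m1 subrr mulr0.
    by move/eqP; rewrite mulf_eq0 (negPf F2) orbF => ->.
  by apply: (mulIf F2); rewrite -m1 m0 kappaE; ring.
exists lam; split=> // [|i j].
  by move: nzk; rewrite kappaE oppr_eq0 mulf_eq0 (negPf F2) orbF.
have [-> | nz_i] := eqVneq i 0; first by rewrite shift_0j mulr0 mul0r.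
apply: (mulIf F2); have := shift_scale i (j / i).
rewrite (mulrC i (j / i)) divfK // => ->; rewrite f1 kappaE.
by field.
Qed.

(* If kappa = 0, then m |-> shift 1 m^-1 and m |-> m * shift 1 m^-1 both permute
   the nonzero scalars, so Wilson's product -1 would be its own square. *)
Lemma shift_commuting : (2 : F) != 0 -> kappa != 0.
Proof.
move=> F2; apply/eqP=> kappa0.
have fE m r : shift m (m * r) = m * shift 1 r.
  by apply: (mulIf F2); rewrite shift_scale kappa0 !mul0r subr0 mulrA.
have nz1 : (1 : F) != 0 by rewrite oner_eq0.
have nz_f (m : F) : m != 0 -> shift 1 m^-1 != 0.
  by move=> nz_m; rewrite shift_neq0 // invr_eq0.
have prod_g : \prod_(m : F | m != 0) (m * shift 1 m^-1) = -1.
  apply: prod_nonzero_inj => [m nz_m | m n nz_m nz_n]; first by rewrite mulf_neq0 ?nz_f.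
  rewrite -!fE !mulfV //; exact: shift_inv.
have prod_f : \prod_(m : F | m != 0) shift 1 m^-1 = -1.
  by apply: prod_nonzero_inj => // m n _ _ /(shift_inj nz1)/invr_inj.
move: prod_g; rewrite big_split /= prod_nonzero prod_f mulrNN mulr1 => /eqP.
by rewrite -addr_eq0 (negPf F2).
Qed.

Lemma shift_form : exists lam : F,
  [/\ lam != 0, kappa = - (lam * 2) & forall i j, shift i j = lam * i * j].
Proof.
have [F2 | F2] := eqVneq (2 : F) 0; first exact: shift_even.
exact: shift_odd (shift_commuting F2).
Qed.

Local Close Scope ring_scope.

(** * The Heisenberg group law *)

Section Heisenberg.

Variable lam : F.
Hypothesis lam_neq0 : lam != 0%R.
Hypothesis kappaE : kappa = (- (lam * 2))%R.
Hypothesis shift_bilinear : forall i j, shift i j = (lam * i * j)%R.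

(** The term - i j cancels the S-part of b^i a^j, so that k = 0 describes E; with kappa = - 2 lam it
    also makes the cocycle the alternating form i j' - j i' that occurs in [symp]. *)
Definition heis (i j k : F) : gT := b ^+ i * a ^+ j * x ^+ (lam * (k - i * j))%R.

Lemma heis_K i j k : heis i j k \in K.
Proof. by rewrite !groupM ?groupX // (subsetP sSK). Qed.

Lemma heis_onto g : g \in K -> exists i j k, g = heis i j k.
Proof.
move=> Kg; have [s [b' [a' [Ss Ab' Aa' eq_g]]]] := decomp3 neq_i Kg.
have expF c (H : {group gT}) : #|H| = t -> c \in H -> c != 1 ->
      forall h, h \in H -> exists i : F, h = c ^+ i.
  move=> oH Hc ntc h; rewrite (prime_cycle oH Hc ntc) => /cycleP[n ->].
  by exists (n%:R%R); rewrite expg_natF // -oH expg_cardG.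
have [i def_b] := expF b _ (oA i1) Ab ntb _ Ab'.
have [j def_a] := expF a _ (oA i2) Aa nta _ Aa'.
have [l def_s] := expF x _ oS Sx ntx _ Ss.
exists i, j, (i * j - l / lam)%R; rewrite /heis addrAC subrr sub0r mulrN.
rewrite mulrC divfK // expgF_N // -def_b -def_a -def_s -eq_g.
have Ks : s^-1 \in S by rewrite groupV.
have Ksg : s * g \in K by rewrite groupM // (subsetP sSK).
by rewrite -(cent_S Ks Ksg) mulKg.
Qed.

Lemma heis_mul i j k i' j' k' :
  heis i j k * heis i' j' k' = heis (i + i')%R (j + j')%R (k + k' + (i * j' - j * i'))%R.
Proof.
rewrite /heis; set u := (lam * (k - _))%R; set v := (lam * (k' - _))%R.
have -> : (lam * (k + k' + (i * j' - j * i') - (i + i') * (j + j')))%R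
        = (kappa * (j * i') + (u + v))%R by rewrite kappaE /u /v; ring.
have cu (l : F) n : commute (x ^+ l) (a ^+ n) by apply: cx; rewrite groupX.
have cb (l : F) n : commute (x ^+ l) (b ^+ n) by apply: cx; rewrite groupX.
have key : a ^+ j * b ^+ i' = b ^+ i' * a ^+ j * x ^+ (kappa * (j * i'))%R.
  by rewrite commgC comm_pow.
move: (kappa * (j * i'))%R => w in key *.
rewrite !expgF_D // -!mulgA; congr (_ * _).
rewrite (mulgA (x ^+ u) (b ^+ i')) cb -mulgA (mulgA (x ^+ u) (a ^+ j')) cu -!mulgA.
by rewrite (mulgA (a ^+ j) (b ^+ i')) key -!mulgA (mulgA (x ^+ w) (a ^+ j')) cu -!mulgA.
Qed.

Lemma heis_transv i j k : (heis i j k \in transv) = (k == 0%R).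
Proof.
have [c Ec eq_c] := shiftP i j.
have -> : heis i j k = x ^+ (lam * k)%R * c.
  rewrite /heis -cx ?groupM ?groupX // eq_c mulgA -expgF_D //.
  by rewrite shift_bilinear; congr (x ^+ (nat_of_ord _) * c); ring.
have -> : (k == 0%R) = (x ^+ (lam * k)%R == 1) by rewrite expgF_eq1 // mulf_eq0 (negPf lam_neq0).
apply/idP/eqP=> [Exc | ->]; last by rewrite mul1g.
by have [] := decomp_inj (groupX _ Sx) (group1 S) Ec Exc (esym (mul1g _)).
Qed.

Lemma heis_S i j k : (heis i j k \in S) = (i == 0%R) && (j == 0%R).
Proof.
rewrite /heis groupMr ?groupX //; apply/idP/andP=> [Sba | [/eqP-> /eqP->]]; last first.
  by rewrite mulg1 group1.
have bi1 : b ^+ i = 1.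
  apply: (tangencyl neq_i (groupX i Ab) (groupVr (groupX j Aa)) Sba).
  by rewrite mulgK.
have aj1 : a ^+ j = 1.
  rewrite bi1 mul1g in Sba.
  exact: (AS_TI (groupX j Aa) Sba).
by rewrite -(expgF_eq1 t_pr bt) // -(expgF_eq1 t_pr at_) // bi1 aj1 !eqxx.
Qed.

End Heisenberg.

End Coordinates.

Lemma heisenberg_coordinates : exists e : 'F_t -> 'F_t -> 'F_t -> gT,
  [/\ forall i j k, e i j k \in K,
      forall g, g \in K -> exists i j k, g = e i j k,
      forall i j k i' j' k', e i j k * e i' j' k' =
        e (i + i')%R (j + j')%R (k + k' + (i * j' - j * i'))%R,
      forall i j k, (e i j k \in transv) = (k == 0%R)
    & forall i j k, (e i j k \in S) = (i == 0%R) && (j == 0%R)].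
Proof.
have /trivgPn[x Sx ntx] : S :!=: 1 by rewrite -cardG_gt1 oS.
have [i1 _] : exists i, i \in [set: I] by apply/card_gt0P; rewrite cardsT oI.
have [i2 neq_i21] := exists_other i1; have neq_i : i1 != i2 by rewrite eq_sym.
have /trivgPn[b Ab ntb] : A i1 :!=: 1 by rewrite -cardG_gt1 oA.
have /trivgPn[a Aa nta] : A i2 :!=: 1 by rewrite -cardG_gt1 oA.
have [Ka Kb] := (subsetP (sAK i2) a Aa, subsetP (sAK i1) b Ab).
have [kappa comm_ab] := mem_S_exp Sx ntx (der_sub Ka Kb).
have [lam [nz_lam kappaE shiftE]] := shift_form Sx ntx neq_i Ab ntb Aa nta comm_ab.
exists (heis x a b lam); split.
- exact: (heis_K Sx Ab Aa).
- exact: (heis_onto Sx ntx neq_i Ab ntb Aa nta nz_lam).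
- exact: (heis_mul Sx Ab Aa comm_ab kappaE).
- exact: (heis_transv Sx ntx Ab Aa nz_lam shiftE).
- exact: (heis_S Sx neq_i Ab ntb Aa nta).
Qed.

End Kantor.

(** * The symplectic form *)

Section SymplecticForm.

Local Open Scope ring_scope.

Variable F : finFieldType.
Implicit Types u v w : 'rV[F]_4.

Lemma sum4 (f : 'I_4 -> F) :
  \sum_i f i = f (inord 0) + f (inord 1) + f (inord 2) + f (inord 3).
Proof.
rewrite !big_ord_recr big_ord0 /= add0r.
by congr (f _ + f _ + f _ + f _); apply: val_inj; rewrite /= inordK.
Qed.

Lemma symp0 u : symp u 0 = 0.
Proof. by rewrite /symp !mxE; ring. Qed.

Lemma sympZ u v c : symp u (c *: v) = c * symp u v.
Proof. by rewrite /symp !mxE; ring. Qed.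

Lemma sympD u v w : symp u (v + w) = symp u v + symp u w.
Proof. by rewrite /symp !mxE; ring. Qed.

Lemma sympC u v : symp u v = - symp v u.
Proof. by rewrite /symp; ring. Qed.

Lemma sympp u : symp u u = 0.
Proof. by rewrite /symp; ring. Qed.

Lemma symp_eq0C u v : (symp u v == 0) = (symp v u == 0).
Proof. by rewrite sympC oppr_eq0. Qed.

Definition gram : 'M[F]_4 := \matrix_(i, j)
  (((i == 0 :> nat) && (j == 1 :> nat))%N%:R - ((i == 1 :> nat) && (j == 0 :> nat))%N%:R
   + ((i == 2 :> nat) && (j == 3 :> nat))%N%:R - ((i == 3 :> nat) && (j == 2 :> nat))%N%:R).

Lemma sympE u v : symp u v = (u *m (gram *m v^T)) 0 0.
Proof.
rewrite mxE sum4 !mxE !sum4 !mxE !inordK //=.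
by rewrite /symp; ring.
Qed.

Lemma gram_unit : gram \in unitmx.
Proof.
suff: gram *m gram = - 1%:M.
  move/(congr1 (fun A => - A)); rewrite opprK -mulmxN => /mulmx1_unit[]; done.
apply/matrixP=> i j; rewrite !mxE sum4 !mxE !inordK //=.
by case: i j => [[|[|[|[|]]]] ?] //= [[|[|[|[|]]]] ?] //=; rewrite ?eqE /=; ring.
Qed.

Lemma symp_nondeg u : (forall w, symp w u = 0) -> u = 0.
Proof.
move=> u0; have: gram *m u^T = 0.
  apply/matrixP=> i j; rewrite ord1 [RHS]mxE -(u0 (delta_mx 0 i)) sympE -rowE.
  by rewrite [RHS]mxE.
move/(congr1 (mulmx (invmx gram))); rewrite mulKmx ?gram_unit // mulmx0.
by move/(congr1 trmx); rewrite trmxK trmx0.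
Qed.

(** Choose c so that v - c u is orthogonal to some w0 not in the perp of u. Any w is a multiple of
    w0 plus a vector in the common perp, so v - c u is orthogonal to everything. *)
Lemma symp_perp_line u v : u != 0 -> v != 0 ->
  (forall w, (symp u w == 0) = (symp v w == 0)) -> <[u]>%VS = <[v]>%VS.
Proof.
move=> nzu nzv eq_perp.
have [w0 uw0] : exists w0, symp w0 u != 0.
  apply/existsP; apply: contraNT nzu => /existsPn u0; apply/eqP/symp_nondeg => w.
  by apply/eqP/negPn/u0.
have uw0' : symp u w0 != 0 by rewrite symp_eq0C.
pose c := symp v w0 / symp u w0.
have def_v : v - c *: u = 0.
  apply: symp_nondeg => w; pose d := symp u w / symp u w0.
  have : symp u (- d *: w0 + w) == 0 by rewrite sympD sympZ mulNr divfK // addNr.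
  rewrite eq_perp (sympD v) (sympZ v) mulNr addrC subr_eq0 => /eqP vw.
  rewrite addrC -scaleNr sympD sympZ [symp w u]sympC [symp w v]sympC vw /c /d.
  by field.
have def_v' : v = c *: u by apply/eqP; rewrite -subr_eq0 def_v.
apply/eqP; rewrite eq_sym eqEdim -memvE !dim_vline nzu nzv andbT def_v'.
by rewrite memvZ ?memv_line.
Qed.

(** A totally isotropic plane lies in its perp, which has dimension 4 - 2 by nondegeneracy; so the
    two coincide. The dimension is computed as the rank of a kernel. *)
Lemma symp_perp_plane u v w : \dim (<[u]> + <[v]>)%VS = 2%N ->
  symp u v = 0 -> symp w u = 0 -> symp w v = 0 -> w \in (<[u]> + <[v]>)%VS.
Proof.
move=> dim2 uv wu wv; pose A := col_mx u v.
have memA w' : (w' <= A)%MS -> w' \in (<[u]> + <[v]>)%VS.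
  case/submxP=> D ->; rewrite -[D]hsubmxK mul_row_col.
  rewrite [lsubmx D]mx11_scalar [rsubmx D]mx11_scalar !mul_scalar_mx.
  by apply: memv_add; rewrite memvZ ?memv_line.
have not_in (a b : 'rV[F]_4) : \dim (<[a]> + <[b]>)%VS = 2%N -> a \notin <[b]>%VS.
  move=> dim_ab; apply/negP; rewrite memvE => /addv_idPr ab.
  by move: dim_ab; rewrite ab dim_vline; case: (b != 0).
have u_v := not_in u v dim2; rewrite addvC in dim2; have v_u := not_in v u dim2.
have rkA : \rank A = 2%N.
  apply/eqP; rewrite -[_ == _]/(row_free A) -kermx_eq0; apply/rowV0P=> D /sub_kermxP.
  rewrite -[D]hsubmxK mul_row_col [lsubmx D]mx11_scalar [rsubmx D]mx11_scalar.
  rewrite !mul_scalar_mx; set a := lsubmx D 0 0; set b := rsubmx D 0 0 => ab0.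
  have coef0 (c d : F) (y z : 'rV[F]_4) : c *: y + d *: z = 0 -> y \notin <[z]>%VS -> c = 0.
    move/eqP; rewrite addr_eq0 => /eqP cy; apply: contraNeq => nzc.
    by rewrite -(scalerK nzc y) cy memvZ // memvN memvZ // memv_line.
  have a0 := coef0 _ _ _ _ ab0 u_v.
  have b0 : b = 0 by apply: coef0 v_u; rewrite addrC; apply: ab0.
  by rewrite a0 b0 raddf0 row_mx0.
have perpE w' : (w' <= kermx (gram *m A^T))%MS = (symp w' u == 0) && (symp w' v == 0).
  have m11 (M : 'M[F]_1) : (M == 0) = (M 0 0 == 0).
    apply/eqP/eqP=> [-> | M0]; first by rewrite mxE.
    by rewrite [M]mx11_scalar M0 raddf0.
  by rewrite !sympE (sameP sub_kermxP eqP) /A tr_col_mx !mul_mx_row row_mx_eq0 !m11.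
have sub : (A <= kermx (gram *m A^T))%MS.
  by rewrite col_mx_sub !perpE !sympp uv sympC uv oppr0 eqxx.
have rk : \rank (kermx (gram *m A^T)) = 2%N.
  by rewrite mxrank_ker -mxrank_tr trmx_mul trmxK mxrankMfree ?rkA //
    row_free_unit unitmx_tr gram_unit.
have sub' : (kermx (gram *m A^T) <= A)%MS.
  by have [_ /esym] := mxrank_leqif_sup sub; rewrite rkA rk eqxx.
by apply: memA; apply: submx_trans sub'; rewrite perpE wu wv eqxx.
Qed.

End SymplecticForm.

(** * Generalized quadrangles of order t *)

Lemma card_dep (T1 T2 : finType) (Y : {set T1}) (f : T1 -> {set T2}) n :
  {in Y, forall u, #|f u| = n} ->
  #|[set v : T1 * T2 | (v.1 \in Y) && (v.2 \in f v.1)]| = (#|Y| * n)%N.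
Proof.
move=> card_f; rewrite -sum1dep_card.
rewrite -(pair_big_dep (mem Y) (fun u v => v \in f u) (fun _ _ => 1%N)) /=.
under eq_bigr => u Yu do rewrite sum1_card card_f //.
by rewrite sum_nat_const.
Qed.

Lemma sub_card_eq (T : finType) (A B : {set T}) :
  A \subset B -> #|B| <= #|A| -> B \subset A.
Proof. by move=> sAB leBA; have /eqP-> : A == B by rewrite eqEcard sAB. Qed.

Section Quadrangle.

Variable G : geometry.
Hypothesis GQ : thick_GQ G.

Implicit Types (y z w : point G) (l m : line G).

Lemma colP y z : reflect (exists2 l, inc y l & inc z l) (collinear y z).
Proof. by apply: (iffP existsP) => [[l /andP[]] | [l yl zl]]; exists l; rewrite ?yl. Qed.

Lemma col_sym y z : collinear y z = collinear z y.
Proof. by apply/colP/colP=> [] [l]; exists l. Qed.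

Lemma line_uniq y z l m :
  y != z -> inc y l -> inc z l -> inc y m -> inc z m -> l = m.
Proof.
move=> neq_yz yl zl ym zm; apply/eqP/negPn/negP=> neq_lm.
case: GQ => [[no2 _] _ _]; apply: no2.
exists (tnth [tuple y; z]), (tnth [tuple l; m]); split.
- by apply/tuple_uniqP; rewrite /= inE neq_yz.
- by apply/tuple_uniqP; rewrite /= inE neq_lm.
- by case=> [[|[|]]] // i_lt; rewrite !(tnth_nth y, tnth_nth l).
Qed.

Lemma triangle_line y z w l1 l2 l3 :
    y != z -> z != w -> y != w -> inc y l1 -> inc z l1 ->
    inc z l2 -> inc w l2 -> inc y l3 -> inc w l3 ->
  inc w l1.
Proof.
move=> neq_yz neq_zw neq_yw yl1 zl1 zl2 wl2 yl3 wl3; apply/negPn/negP=> wl1.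
case: GQ => [[_ no3] _ _]; apply: no3.
exists (tnth [tuple y; z; w]), (tnth [tuple l1; l2; l3]); split.
- by apply/tuple_uniqP; rewrite /= !inE negb_or neq_yz neq_yw neq_zw.
- apply/tuple_uniqP; rewrite /= !inE negb_or andbT -andbA.
  have neq12 : l1 != l2 by apply: contraNneq wl1 => ->.
  rewrite neq12 (contraNneq _ wl1) => [|-> //].
  apply: contraNneq neq12 => eq23; apply/eqP/(line_uniq neq_yz) => //.
  by rewrite eq23.
- by case=> [[|[|[|]]]] // i_lt; rewrite !(tnth_nth y, tnth_nth l1).
Qed.

Lemma projection y l : ~~ inc y l -> exists z m, [/\ inc y m, inc z m & inc z l].
Proof.
move=> yl; case: GQ => _ /(_ (inl y) (inr l))[p [n [[_ _ gon] [i def_y] [j def_l]]]] _.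
have [gi gSi] := gon i; have [gj gSj] := gon j.
(* The vertex [p i] is either on the side [n j] or adjacent to one of its ends; that end is the
   projection. *)
have : [|| i == j, i == ordS j, j == ordS i | i == ordS (ordS j)].
  by case: i j {def_y def_l gi gSi gj gSj} => [[|[|[|[|]]]] //= ?] [[|[|[|[|]]]] //= ?].
case/or4P=> /eqP def_i; subst.
- by rewrite gj in yl.
- by rewrite gSj in yl.
- by exists (p (ordS i)), (n i).
- exists (p (ordS j)), (n (ordS j)); split=> //.
    by have [] := gon (ordS j).
  by have [] := gon (ordS j).
Qed.

Lemma projection_uniq y l z w :
  ~~ inc y l -> inc z l -> inc w l -> collinear z y -> collinear w y -> z = w.
Proof.
move=> yl zl wl /colP[m zm ym] /colP[n wn yn]; apply/eqP/negPn/negP=> neq_zw.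
have neq y' : inc y' l -> y' != y by move=> y'l; apply: contraNneq yl => <-.
by move: yl; rewrite (triangle_line neq_zw (neq _ wl) (neq _ zl) zl wl wn yn zm ym).
Qed.

Variable t : nat.
Hypothesis ord_t : has_order G t t.

Lemma card_points l : #|[set y | inc y l]| = t.+1. Proof. by case: ord_t. Qed.
Lemma card_lines y : #|[set l | inc y l]| = t.+1. Proof. by case: ord_t. Qed.

Lemma order_gt0 : 0 < t.
Proof.
case: GQ => _ quad [p _];
have [q [n [[inj_q inj_n gon] _ _]]] := quad (inl (p ord0)) (inl (p ord0)).
have := subset_leq_card (_ : [set n ord0; n ord_max] \subset [set l | inc (q ord0) l]).
rewrite card_lines cards2 (inj_eq inj_n) /=; apply.
apply/subsetP=> l; rewrite !inE => /orP[] /eqP->; first by have [] := gon ord0.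
have [_] := gon ord_max; congr (inc (q _) _); exact: val_inj.
Qed.

(** For t = 1 each side of the pentagon carries just its two vertices and each vertex lies on just
    its two sides, so [p i0] has no projection on the opposite side. *)
Lemma order_gt1 : 1 < t.
Proof.
rewrite ltn_neqAle order_gt0 andbT; apply/eqP=> t1.
case: GQ => _ _ [p [n [inj_p inj_n gon]]].
have pts i y : inc y (n i) -> y \in [set p i; p (ordS i)].
  have sub : [set p i; p (ordS i)] \subset [set y | inc y (n i)].
    by apply/subsetP=> z; rewrite !inE => /orP[] /eqP->; have [] := gon i.
  have/subsetP sub' : [set y | inc y (n i)] \subset [set p i; p (ordS i)].
    apply: sub_card_eq sub _; rewrite card_points -t1 cards2 (inj_eq inj_p).
    by case: i => [[|[|[|[|[|]]]]]].
  by move=> yi; apply: sub'; rewrite inE.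
pose i0 : 'I_5 := ord0; pose i2 : 'I_5 := Ordinal (isT : 2 < 5).
have lns l : inc (p i0) l -> l \in [set n i0; n ord_max].
  have sub : [set n i0; n ord_max] \subset [set l | inc (p i0) l].
    apply/subsetP=> m; rewrite !inE => /orP[] /eqP->; first by have [] := gon i0.
    have [_] := gon ord_max; congr (inc (p _) _); exact: val_inj.
  have/subsetP sub' : [set l | inc (p i0) l] \subset [set n i0; n ord_max].
    by apply: sub_card_eq sub _; rewrite card_lines -t1 cards2 (inj_eq inj_n).
  by move=> yi; apply: sub'; rewrite inE.
have not_on : ~~ inc (p i0) (n i2).
  by apply/negP=> /pts; rewrite !inE !(inj_eq inj_p).
have [z [m [/lns zm zl /pts]]] := projection not_on.
move: zm zl; rewrite !inE => /orP[] /eqP-> /pts; rewrite !inE => /orP[] /eqP->;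
  by rewrite !(inj_eq inj_p).
Qed.

Lemma exists_line y l : exists2 m, inc y m & m != l.
Proof.
have: 0 < #|[set m | inc y m] :\ l|.
  have := cardsD1 l [set m | inc y m]; rewrite card_lines; case: (l \in _) => /=.
    by rewrite add1n => -[<-]; apply: order_gt0.
  by rewrite add0n => <-.
by case/card_gt0P=> m; rewrite !inE => /andP[neq_ml ym]; exists m.
Qed.

Lemma exists_point l y : exists2 z, inc z l & z != y.
Proof.
have: 0 < #|[set z | inc z l] :\ y|.
  have := cardsD1 y [set z | inc z l]; rewrite card_points; case: (y \in _) => /=.
    by rewrite add1n => -[<-]; apply: order_gt0.
  by rewrite add0n => <-.
by case/card_gt0P=> z; rewrite !inE => /andP[neq_zy zl]; exists z.
Qed.

Lemma col_refl y : collinear y y.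
Proof.
have [l yl] : exists l, l \in [set l | inc y l] by apply/card_gt0P; rewrite card_lines.
by rewrite inE in yl; apply/colP; exists l.
Qed.

(** Each of the t + 1 lines on y carries exactly one point collinear with z. *)
Lemma card_trace y z : ~~ collinear y z -> #|perp y :&: perp z| = t.+1.
Proof.
move=> ncol; pose Y := [set l | inc y l].
pose f l := odflt y [pick w | inc w l && collinear w z].
have fP l : inc y l -> inc (f l) l /\ collinear (f l) z.
  move=> yl; have zl : ~~ inc z l by apply: contra ncol => zl; apply/colP; exists l.
  rewrite /f; case: pickP => [w /andP[] // | no_w].
  have [w [m [zm wm wl]]] := projection zl.
  have /andP[] := no_w w; split=> //; apply/colP; exists m => //.
have fE l w : inc y l -> inc w l -> collinear w z -> f l = w.
  move=> yl wl cwz; have [fl cf] := fP l yl.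
  have zl : ~~ inc z l by apply: contra ncol => zl; apply/colP; exists l.
  exact: projection_uniq zl fl wl cf cwz.
have -> : perp y :&: perp z = f @: Y.
  apply/setP=> w; rewrite !inE; apply/andP/imsetP=> [[/colP[l wl yl] cwz] | [l]].
    by exists l; rewrite ?inE // (fE _ w).
  rewrite inE => yl ->; have [fl cf] := fP l yl; split=> //.
  by apply/colP; exists l.
rewrite card_in_imset ?card_lines // => l m; rewrite !inE => yl ym eq_f.
have [[fl cf] [fm _]] := (fP l yl, fP m ym); rewrite -eq_f in fm.
apply: (line_uniq _ yl fl ym fm); apply: contraNneq ncol => ->; exact: cf.
Qed.

(** Fix a line l on x. Each z arises from exactly one chain: a point w != x of l, a line m != l on
    w, and a point z != w of m, with t choices each. *)
Lemma card_noncollinear (x : point G) : #|~: perp x| = (t ^ 3)%N.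
Proof.
have [l] : exists l, l \in [set l | inc x l] by apply/card_gt0P; rewrite card_lines.
rewrite inE => xl.
pose W := [set w | inc w l] :\ x.
pose L w := [set m | inc w m] :\ l.
pose WL := [set v : point G * line G | (v.1 \in W) && (v.2 \in L v.1)].
pose Z (v : point G * line G) := [set z | inc z v.2] :\ v.1.
pose T := [set v : point G * line G * point G | (v.1 \in WL) && (v.2 \in Z v.1)].
have card1 (X : finType) (A : {set X}) a : a \in A -> #|A| = t.+1 -> #|A :\ a| = t.
  by move=> Aa; rewrite (cardsD1 a) Aa => -[].
have oT : #|T| = (t ^ 3)%N.
  rewrite (@card_dep _ _ _ _ t) => [|[w m]].
    rewrite (@card_dep _ _ _ _ t) => [|w].
      by rewrite card1 ?inE ?card_points // !expnS expn0 muln1 mulnA.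
    by rewrite !inE => /andP[_ wl]; rewrite card1 ?inE ?card_lines.
  by rewrite !inE /= => /andP[_ /andP[_ wm]]; rewrite card1 ?inE ?card_points.
have TP w m z : (w, m, z) \in T ->
    [/\ inc w l, w != x, inc w m, m != l & inc z m /\ ~~ inc z l].
  rewrite !inE /= => /andP[/andP[/andP[nwx wl] /andP[nml wm]] /andP[nzw zm]].
  split=> //; split=> //; apply: contra nml => zl.
  by rewrite (line_uniq nzw zm wm zl wl).
rewrite -oT; suff -> : ~: perp x = [set v.2 | v in T].
  rewrite card_in_imset // => -[[w m] z] [[w' m'] z'] /TP[wl nwx wm nml [zm zl]].
  case/TP=> [w'l nw'x w'm' nm'l [z'm' z'l]] /= eq_z; subst z'.
  have eq_w : w = w'.
    by apply: (projection_uniq zl wl w'l); apply/colP; [exists m | exists m'].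
  subst w'; congr (_, _, _); apply: (line_uniq _ wm zm w'm' z'm').
  by apply: contraNneq zl => <-.
apply/setP=> z; rewrite !inE; apply/idP/imsetP=> [nzx | [[[w m] z'] Tv ->]] /=.
  have zl : ~~ inc z l by apply: contra nzx => zl; apply/colP; exists l.
  have [w [m [zm wm wl]]] := projection zl.
  have nwx : w != x by apply: contraNneq nzx => <-; apply/colP; exists m.
  have nml : m != l by apply: contraNneq zl => <-.
  have nzw : z != w by apply: contraNneq zl => ->.
  by exists (w, m, z); rewrite // !inE /= wl wm zm nwx nml nzw.
have [wl nwx wm nml [zm zl]] := TP _ _ _ Tv.
apply: contra zl => /colP[n zn xn]; have [<- // | neq_xz] := eqVneq x z'.
have neq_xw : x != w by rewrite eq_sym.
have neq_wz : w != z' by move: Tv; rewrite !inE /= => /andP[_ /andP[]]; rewrite eq_sym.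
exact: (triangle_line neq_xw neq_wz neq_xz xl wl wm zm xn zn).
Qed.

(** * The Kantor family of a skew translation quadrangle *)

Section Skew.

Variables (x : point G) (K : {group permT G}).
Hypothesis autK : K \subset automorphisms G.
Hypothesis fixK : forall (g : permT G) l, g \in K -> inc x l -> g.2 l = l.
Hypothesis sharpK : sharply_transitive K (~: perp x).
Hypothesis centx : center_of_symmetry x.
Hypothesis sSK : symmetries x \subset K.

Implicit Types g h : permT G.

Lemma aut_inc g y l : g \in automorphisms G -> inc (g.1 y) (g.2 l) = inc y l.
Proof. by rewrite inE => /forallP/(_ y)/forallP/(_ l)/eqP. Qed.

Lemma aut_col g y z : g \in automorphisms G -> collinear (g.1 y) (g.1 z) = collinear y z.
Proof.
move=> Ag; apply/colP/colP=> [] [l yl zl].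
  exists ((g.2)^-1 l); rewrite -(aut_inc _ _ Ag) permKV //.
by exists (g.2 l); rewrite aut_inc.
Qed.

Let K_inc g y l : g \in K -> inc (g.1 y) (g.2 l) = inc y l.
Proof. by move=> Kg; apply/aut_inc/(subsetP autK). Qed.

Let K_col g y z : g \in K -> collinear (g.1 y) (g.1 z) = collinear y z.
Proof. by move=> Kg; apply/aut_col/(subsetP autK). Qed.

Lemma actMp g h y : (g * h).1 y = h.1 (g.1 y).
Proof. by rewrite permM. Qed.

Lemma actVp g y : g^-1.1 (g.1 y) = y.
Proof. by rewrite -actMp mulgV perm1. Qed.

Lemma actVKp g y : g.1 (g^-1.1 y) = y.
Proof. by rewrite -actMp mulVg perm1. Qed.

Lemma fix_center g : g \in K -> g.1 x = x.
Proof.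
move=> Kg; have [l xl] : exists l, l \in [set l | inc x l].
  by apply/card_gt0P; rewrite card_lines.
rewrite inE in xl; have [m xm neq_ml] := exists_line x l.
apply/eqP; apply: contraNT neq_ml => neq_gx.
have gl : inc (g.1 x) l by rewrite -(fixK Kg xl) K_inc.
have gm : inc (g.1 x) m by rewrite -(fixK Kg xm) K_inc.
by rewrite (line_uniq neq_gx gm xm gl xl).
Qed.

Lemma symP s : reflect (s \in automorphisms G /\ forall z, collinear z x -> s.1 z = z)
  (s \in symmetries x).
Proof.
apply: (iffP setIP) => [[As /astabP fix_s] | [As fix_s]]; split=> //.
  by move=> z zx; apply: fix_s; rewrite inE.
by apply/astabP=> z; rewrite inE; apply: fix_s.
Qed.

Definition symmetry_group : {group permT G} := 'C_(automorphisms_group G)(perp x | pact_action G)%G.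

Lemma sym_normal : symmetry_group <| K.
Proof.
rewrite /normal sSK; apply/subsetP=> g Kg; rewrite inE; apply/subsetP=> _ /imsetP[s Ss ->].
have/symP[As fix_s] : s \in symmetries x by [].
suff: s ^ g \in symmetries x by [].
have Kgs : s ^ g \in K by rewrite groupJ // (subsetP sSK).
apply/symP; split=> [|z zx]; first exact: (subsetP autK).
rewrite conjgE !actMp fix_s ?actVKp //.
by rewrite -(K_col _ _ Kg) actVKp fix_center.
Qed.

Variable y0 : point G.
Hypothesis y0x : ~~ collinear y0 x.

Lemma K_noncol g y : g \in K -> ~~ collinear y x -> ~~ collinear (g.1 y) x.
Proof. by move=> Kg; rewrite -{2}(fix_center Kg) K_col. Qed.

Lemma K_trans z : ~~ collinear z x -> exists2 g, g \in K & g.1 y0 = z.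
Proof.
move=> zx; case: sharpK => _ /(_ y0 z)[||g [[Kg gy] _]]; try by rewrite !inE.
by exists g.
Qed.

Lemma K_free g h z : g \in K -> h \in K -> ~~ collinear z x -> g.1 z = h.1 z -> g = h.
Proof.
move=> Kg Kh zx eq_gh; have gzx := K_noncol Kg zx.
case: sharpK => _ /(_ z (g.1 z))[||u [_ uniq_u]]; try by rewrite !inE.
by rewrite -(uniq_u g) // -(uniq_u h).
Qed.

Lemma card_K : #|K| = (t ^ 3)%N.
Proof.
rewrite -(card_noncollinear x); have <- : [set pact y0 g | g in K] = ~: perp x.
  apply/setP=> z; rewrite !inE; apply/imsetP/idP=> [[g Kg ->] | /K_trans[g Kg <-]].
    exact: K_noncol.
  by exists g.
by rewrite card_in_imset // => g h Kg Kh; apply: K_free.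
Qed.

(** The set D has t points, none collinear with x, for otherwise y and z would be collinear. As K
    acts freely off [perp x], the transitive action of the symmetries on D is regular. *)
Lemma card_sym : #|symmetry_group| = t.
Proof.
case: centx => y [z [yx zx ncol trS]]; rewrite !inE in yx zx.
set D := _ :\ x in trS.
have xy : x \in perp y :&: perp z by rewrite !inE ![collinear x _]col_sym yx.
have oD : #|D| = t by have := cardsD1 x (perp y :&: perp z); rewrite xy card_trace // => -[].
have [u Du] : exists u, u \in D by apply/card_gt0P; rewrite oD order_gt0.
have ux : ~~ collinear u x.
  move: Du; rewrite !inE => /and3P[neq_ux /colP[l1 ul1 yl1] /colP[l2 ul2 zl2]].
  apply/negP=> /colP[l3 ul3 xl3]; case/negP: ncol.
  have on3 w : collinear w x -> collinear u w -> inc w l3.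
    move=> /colP[m wm xm] /colP[n un wn].
    have [-> // | neq_wx] := eqVneq w x; have [<- // | neq_uw] := eqVneq u w.
    by apply: (triangle_line neq_ux _ neq_uw ul3 xl3 xm wm un wn); rewrite eq_sym.
  by apply/colP; exists l3; apply: on3 => //; apply/colP; [exists l1 | exists l2].
have defD : [set pact u s | s in symmetry_group] = D by rewrite -(atransP trS u Du).
rewrite -oD -defD card_in_imset // => s s' Ss Ss' eq_s.
by apply: K_free eq_s; rewrite ?(subsetP sSK).
Qed.

(* The lines through the centre index the Kantor family. *)
Definition xline : finType := {l : line G | inc x l}.

Lemma card_xline : #|xline| = t.+1.
Proof. by rewrite card_sig -(card_lines x) cardsE. Qed.

Lemma y0_off (i : xline) : ~~ inc y0 (val i).
Proof. by apply: contra y0x => yl; apply/colP; exists (val i) => //; apply: (valP i). Qed.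

Lemma exists_proj : exists pm : xline -> point G * line G,
  forall i, [/\ inc (pm i).1 (val i), inc (pm i).1 (pm i).2 & inc y0 (pm i).2].
Proof.
have /fin_all_exists[pm pmP] : forall i : xline, exists u : point G * line G,
    [/\ inc u.1 (val i), inc u.1 u.2 & inc y0 u.2].
  move=> i; have [z [m [ym zm zl]]] := projection (y0_off i).
  by exists (z, m).
by exists pm.
Qed.

Variable pm : xline -> point G * line G.
Hypothesis pmP : forall i, [/\ inc (pm i).1 (val i), inc (pm i).1 (pm i).2 & inc y0 (pm i).2].

(** [pr i] is the projection of [y0] on the line i through x, and [ml i] is the line joining
    them. *)
Let pr i := (pm i).1.
Let ml i := (pm i).2.

Let pr_x i : inc (pr i) (val i). Proof. by case: (pmP i). Qed.
Let pr_m i : inc (pr i) (ml i). Proof. by case: (pmP i). Qed.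
Let y0_m i : inc y0 (ml i). Proof. by case: (pmP i). Qed.
Let x_l (i : xline) : inc x (val i). Proof. exact: (valP i). Qed.

Let pr_colx i : collinear (pr i) x. Proof. by apply/colP; exists (val i). Qed.
Let pr_neq i z : ~~ collinear z x -> z != pr i.
Proof. by apply: contraNneq => ->. Qed.
Let prx i : pr i != x.
Proof. by apply: contraNneq y0x => def_x; apply/colP; exists (ml i); rewrite -?def_x. Qed.
Let x_notm i : ~~ inc x (ml i).
Proof. by apply: contra y0x => xm; apply/colP; exists (ml i). Qed.

Lemma noncol_off (i : xline) z : ~~ collinear z x -> ~~ inc z (val i).
Proof. by apply: contra => zl; apply/colP; exists (val i). Qed.

Lemma pr_off i j : i != j -> ~~ inc (pr j) (ml i).
Proof.
move=> neq_ij; apply/negP=> prj; have [eq_pr | neq_pr] := eqVneq (pr i) (pr j).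
  case/eqP: neq_ij; apply: val_inj; apply: (line_uniq (prx i)) => //.
  by rewrite eq_pr.
have := x_notm i; rewrite (triangle_line neq_pr (prx j) (prx i) (pr_m i) prj
  (pr_x j) (x_l j) (pr_x i) (x_l i)) //.
Qed.

Lemma ml_meet i j z : i != j -> inc z (ml i) -> inc z (ml j) -> z = y0.
Proof.
move=> neq_ij zi zj; apply/eqP; apply: contraNT (pr_off neq_ij) => neq_z.
by rewrite (line_uniq neq_z zi (y0_m i) zj (y0_m j)).
Qed.

Lemma line_stab_group_set i : group_set [set g in K | g.2 (ml i) == ml i].
Proof.
apply/group_setP; split=> [|g h]; first by rewrite inE group1 perm1 eqxx.
rewrite !inE => /andP[Kg /eqP gm] /andP[Kh /eqP hm].
by rewrite groupM //= permM gm hm.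
Qed.

Definition line_stab i : {group permT G} := Group (line_stab_group_set i).

(** Since g fixes the line i, both [pr i] and its image are projections of the image of [y0] on that
    line; they coincide, and then so do [ml i] and its image. *)
Lemma line_stabP g i : g \in K -> (g \in line_stab i) = inc (g.1 y0) (ml i).
Proof.
move=> Kg; rewrite inE Kg /=; apply/eqP/idP=> [gm | gy].
  by rewrite -gm K_inc.
have off := noncol_off i (K_noncol Kg y0x).
have gpr : inc (g.1 (pr i)) (val i) by rewrite -(fixK Kg (x_l i)) K_inc.
have eq_pr : g.1 (pr i) = pr i.
  apply: (projection_uniq off gpr (pr_x i)); apply/colP.
    by exists (g.2 (ml i)); rewrite K_inc.
  by exists (ml i).
apply: (line_uniq (pr_neq i (K_noncol Kg y0x)) _ _ gy (pr_m i)); first by rewrite K_inc.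
by rewrite -eq_pr K_inc.
Qed.

Lemma line_stab_sub i : line_stab i \subset K.
Proof. by apply/subsetP=> g; rewrite inE => /andP[]. Qed.

Lemma line_stab_y0 i g : g \in line_stab i -> inc (g.1 y0) (ml i).
Proof. by move=> Ag; rewrite -line_stabP // (subsetP (line_stab_sub i)). Qed.

Lemma card_line_stab i : #|line_stab i| = t.
Proof.
have <- : #|[set z | inc z (ml i)] :\ pr i| = t.
  by have := cardsD1 (pr i) [set z | inc z (ml i)]; rewrite inE pr_m card_points => -[].
have <- : [set pact y0 g | g in line_stab i] = [set z | inc z (ml i)] :\ pr i.
  apply/setP=> z; rewrite !inE; apply/imsetP/andP=> [[g Ag ->] | [nz zm]].
    split; last exact: line_stab_y0.
    by apply/pr_neq/K_noncol; rewrite ?(subsetP (line_stab_sub i)).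
  have zx : ~~ collinear z x.
    apply/negP=> /colP[n zn xn]; have := y0_off i.
    have zl : inc z (val i).
      have [<- // | neq_xz] := eqVneq x z.
      have neq_xp : x != pr i by rewrite eq_sym.
      have neq_pz : pr i != z by rewrite eq_sym.
      exact: (triangle_line neq_xp neq_pz neq_xz (x_l i) (pr_x i) (pr_m i) zm xn zn).
    by rewrite (line_uniq nz zl (pr_x i) zm (pr_m i)) y0_m.
  have [g Kg gy] := K_trans zx; exists g; rewrite // line_stabP // gy //.
rewrite card_in_imset // => g h Ag Ah; apply: K_free => //;
  exact: (subsetP (line_stab_sub i)).
Qed.

Lemma sym_fix s z : s \in symmetry_group -> collinear z x -> s.1 z = z.
Proof. by move=> Ss; have /symP[_] : s \in symmetries x by []; apply. Qed.

(** As s fixes [pr j], for a != 1 there would be a triangle on [y0], its image under a, and [pr j],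
    with sides [ml i], the image of [ml j] under s, and [ml j]. *)
Lemma stab_tangency (i j : xline) (a b s : permT G) : i != j -> a \in line_stab i ->
  b \in line_stab j -> s \in symmetry_group -> a = b * s -> a = 1.
Proof.
move=> neq_ij Aa Ab Ss def_a.
have Ka := subsetP (line_stab_sub i) a Aa; have Kb := subsetP (line_stab_sub j) b Ab.
have Ks : s \in K by apply: (subsetP sSK).
have [a1 | neq_ay] := eqVneq (a.1 y0) y0.
  by apply: (K_free Ka (group1 K) y0x); rewrite perm1.
have ax := K_noncol Ka y0x; case/negP: (pr_off neq_ij).
apply: (@triangle_line y0 (a.1 y0) (pr j) (ml i) (s.2 (ml j)) (ml j)) => //.
- by rewrite eq_sym.
- exact: pr_neq.
- exact: pr_neq.
- exact: line_stab_y0.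
- by rewrite def_a actMp K_inc // line_stab_y0.
- by rewrite -(sym_fix Ss (pr_colx j)) K_inc.
Qed.

(** The triangle has as vertices [y0] and its images under b and c; its sides are [ml j], the image
    of [ml i] under b, and [ml k]. *)
Lemma stab_triangle (i j k : xline) (a b c : permT G) : i != j -> i != k -> j != k ->
  a \in line_stab i -> b \in line_stab j -> c \in line_stab k -> a * b = c -> c = 1.
Proof.
move=> neq_ij neq_ik neq_jk Aa Ab Ac def_c.
have Ka := subsetP (line_stab_sub i) a Aa; have Kb := subsetP (line_stab_sub j) b Ab.
have Kc := subsetP (line_stab_sub k) c Ac.
have eq1 g : g \in K -> g.1 y0 = y0 -> g = 1.
  by move=> Kg gy; apply: (K_free Kg (group1 K) y0x); rewrite perm1.
have ay := line_stab_y0 Aa; have byj := line_stab_y0 Ab; have cy := line_stab_y0 Ac.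
apply: (eq1 _ Kc); have [b1 | neq_by] := eqVneq (b.1 y0) y0.
  have c_a : c = a by rewrite -def_c (eq1 b) // mulg1.
  by apply: (ml_meet neq_ik) => //; rewrite c_a.
have [eq_bc | neq_bc] := eqVneq (b.1 y0) (c.1 y0).
  by apply: (ml_meet neq_jk) => //; rewrite -eq_bc.
apply/eqP/negPn/negP=> neq_cy; case/eqP: (neq_cy).
apply: (ml_meet neq_jk) => //.
apply: (@triangle_line y0 (b.1 y0) (c.1 y0) (ml j) (b.2 (ml i)) (ml k)) => //.
- by rewrite eq_sym.
- by rewrite eq_sym.
- by rewrite K_inc.
- by rewrite -def_c actMp K_inc.
Qed.

Lemma col_y0 g : g \in K -> collinear (g.1 y0) y0 = (g \in transv line_stab).
Proof.
move=> Kg; apply/idP/transvP=> [/colP[m gm ym] | [i Ag]]; last first.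
  by apply/colP; exists (ml i); rewrite ?line_stab_y0.
have xm : ~~ inc x m by apply: contra y0x => xm; apply/colP; exists m.
have [z [l [xl zl zm]]] := projection xm.
pose i : xline := exist _ l xl; exists i; rewrite line_stabP //.
have eq_z : z = pr i.
  apply: (projection_uniq (y0_off i)) => //; apply/colP; first by exists m.
  by exists (ml i).
suff <- : m = ml i by [].
apply: (line_uniq (pr_neq i y0x)) => //; by rewrite -eq_z.
Qed.

Lemma fix_pr i g : g \in K -> collinear (g.1 y0) (pr i) -> g.1 (pr i) = pr i.
Proof.
move=> Kg gc; apply: (projection_uniq (noncol_off i (K_noncol Kg y0x))) => //.
- by rewrite -[X in inc _ X](fixK Kg (x_l i)) K_inc.
- by rewrite K_col //; apply/colP; exists (ml i).
- by rewrite col_sym.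
Qed.

(** The product of S and A_i is the stabiliser of [pr i] in K. If c lay in A_j with j != i and c !=
    1, it would fix [pr i], and [y0], its image under c and [pr i] would form a triangle. *)
Lemma col_pr g i : g \in K ->
  reflect (exists s c, [/\ s \in symmetry_group, c \in line_stab i & g = s * c])
    (collinear (g.1 y0) (pr i)).
Proof.
move=> Kg; apply: (iffP idP) => [gc | [s [c [Ss Ac ->]]]]; last first.
  have cy : collinear (c.1 y0) (pr i).
    by apply/colP; exists (ml i); rewrite ?line_stab_y0.
  have Kc := subsetP (line_stab_sub i) c Ac.
  have Ks : s \in K by apply: (subsetP sSK).
  rewrite actMp -(fix_pr Kc cy) K_col // -(sym_fix Ss (pr_colx i)) K_col //.
  by apply/colP; exists (ml i).
have [s [c [Ss /transvP[j Ac] def_g]]] :=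
  decomp sym_normal line_stab_sub order_gt1 card_sym card_line_stab
    card_K card_xline stab_tangency Kg.
have [c1 | ntc] := eqVneq c 1.
  by exists s, c; split=> //; rewrite c1 group1.
have [eq_ij | neq_ij] := eqVneq i j; first by exists s, c; rewrite eq_ij.
have Kc := subsetP (line_stab_sub j) c Ac.
have cpr : c.1 (pr i) = pr i.
  by have := fix_pr Kg gc; rewrite def_g actMp (sym_fix Ss (pr_colx i)).
have neq_ji : j != i by rewrite eq_sym.
case/negP: (pr_off neq_ji).
apply: (@triangle_line y0 (c.1 y0) (pr i) (ml j) (c.2 (ml i)) (ml i)) => //.
- apply: contra_neq ntc => yc.
  by apply: (K_free Kc (group1 K) y0x); rewrite perm1.
- by apply: pr_neq; apply: K_noncol.
- exact: pr_neq.
- exact: line_stab_y0.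
- by rewrite K_inc.
- by rewrite -cpr K_inc.
Qed.

Lemma act_pr_inc g i : g \in K -> inc (g.1 (pr i)) (val i).
Proof. by move=> Kg; rewrite -[X in inc _ X](fixK Kg (x_l i)) K_inc. Qed.

Lemma act_pr_neq g i : g \in K -> g.1 (pr i) != x.
Proof. by move=> Kg; rewrite -(fix_center Kg) (inj_eq perm_inj) prx. Qed.

Lemma col_pr_pr g h i j : g \in K -> h \in K ->
  collinear (g.1 (pr i)) (h.1 (pr j)) = (i == j).
Proof.
move=> Kg Kh; have [gi hj] := (act_pr_inc i Kg, act_pr_inc j Kh).
have [gx hx] := (act_pr_neq i Kg, act_pr_neq j Kh).
apply/idP/eqP=> [/colP[m gm hm] | eq_ij]; last first.
  by apply/colP; exists (val i); rewrite // eq_ij.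
apply: val_inj; apply: (line_uniq hx) => //.
have [<- // | neq_gh] := eqVneq (g.1 (pr i)) (h.1 (pr j)).
have neq_xg : x != g.1 (pr i) by rewrite eq_sym.
have neq_xh : x != h.1 (pr j) by rewrite eq_sym.
exact: (triangle_line neq_xg neq_gh neq_xh (x_l i) gi gm hm (x_l j) hj).
Qed.

(** A point z != x on a line i through x is the projection on it of some point off [perp x], the
    image of [y0] under some g; so z is the image of [pr i] under g. *)
Lemma point_cases z : [\/ z = x, exists2 g, g \in K & z = g.1 y0
  | exists i g, g \in K /\ z = g.1 (pr i)].
Proof.
have [zx | /K_trans[g Kg <-]] := boolP (collinear z x); last by constructor 2; exists g.
have [-> | neq_zx] := eqVneq z x; first by constructor 1.
case/colP: zx => l zl xl; pose i : xline := exist _ l xl.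
have [m zm neq_ml] := exists_line z l; have [u um neq_uz] := exists_point m z.
have ux : ~~ collinear u x.
  apply/negP=> /colP[n un xn]; case/eqP: neq_ml.
  suff ul : inc u l by apply: (line_uniq neq_uz).
  have [<- // | neq_xu] := eqVneq x u.
  have neq_xz : x != z by rewrite eq_sym.
  have neq_zu : z != u by rewrite eq_sym.
  exact: (triangle_line neq_xz neq_zu neq_xu xl zl zm um xn un).
have [g Kg gu] := K_trans ux; constructor 3; exists i, g; split=> //.
apply: (projection_uniq (noncol_off i ux)) => //.
- exact: act_pr_inc.
- by apply/colP; exists m.
- by rewrite -gu K_col //; apply/colP; exists (ml i).
Qed.

(** * Homogeneous coordinates for the points *)

Section Coordinatisation.

Hypothesis cycS : cyclic symmetry_group.

Lemma order_prime : prime t.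
Proof.
rewrite (t_eq_pdiv sym_normal cycS line_stab_sub order_gt1 card_sym card_line_stab
  card_K card_xline stab_tangency stab_triangle).
exact/pdiv_prime/order_gt1.
Qed.

Local Notation F := 'F_t.
Local Notation E := (transv line_stab).

Variable e : F -> F -> F -> permT G.
Hypothesis eK : forall i j k, e i j k \in K.
Hypothesis e_onto : forall g, g \in K -> exists i j k, g = e i j k.
Hypothesis eM : forall i j k i' j' k', e i j k * e i' j' k' =
  e (i + i')%R (j + j')%R (k + k' + (i * j' - j * i'))%R.
Hypothesis eE : forall i j k, (e i j k \in E) = (k == 0%R).
Hypothesis eS : forall i j k, (e i j k \in symmetry_group) = (i == 0%R) && (j == 0%R).

Lemma e0 : e 0%R 0%R 0%R = 1.
Proof.
by apply: (transvS order_gt1 card_xline stab_tangency); rewrite ?eE ?eS ?eqxx.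
Qed.

Lemma eV i j k : (e i j k)^-1 = e (- i)%R (- j)%R (- k)%R.
Proof.
apply/eqP; rewrite eq_invg_mul eM !subrr.
by rewrite (_ : (_ + _)%R = 0%R) ?e0 //; ring.
Qed.

Lemma e_split i j k : e i j k = e 0%R 0%R k * e i j 0%R.
Proof. by rewrite eM !add0r !mul0r subrr !addr0. Qed.

Lemma e_eq1 i j k : e i j k = 1 -> (i == 0%R) && (j == 0%R).
Proof. by move=> e1; rewrite -(eS i j k) e1 group1. Qed.

Lemma exists_dir i j : exists l : xline, e i j 0%R \in line_stab l.
Proof. by apply/transvP; rewrite eE. Qed.

(** For i = j = 0 every line qualifies and the choice is arbitrary; that case is excluded where the
    value matters. *)
Definition dir i j : xline := xchoose (exists_dir i j).

Lemma dirP i j : e i j 0%R \in line_stab (dir i j).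
Proof. exact: xchooseP (exists_dir i j). Qed.

Lemma line_stab_det i j i' j' (l : xline) : e i j 0%R \in line_stab l ->
  e i' j' 0%R \in line_stab l -> (i * j' - j * i')%R = 0%R.
Proof.
move=> Al Al'; have := mem_transv (groupM Al Al').
by rewrite eM eE !add0r => /eqP.
Qed.

(** For proportional vectors the determinant vanishes, so the product stays in E and [no_tri] keeps
    both elements in one component. *)
Lemma dir_eq i j i' j' (l : xline) : ~~ ((i == 0%R) && (j == 0%R)) ->
  e i j 0%R \in line_stab l -> (i * j' - j * i')%R = 0%R -> e i' j' 0%R \in line_stab l.
Proof.
move=> nz Al det0; have Al' := dirP i' j'.
have [<- // | neq_l] := eqVneq (dir i' j') l.
have Eprod : e i j 0%R * e i' j' 0%R \in E by rewrite eM eE !add0r det0.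
rewrite eq_sym in neq_l.
case: (no_tri stab_tangency stab_triangle neq_l Al Al' Eprod) => e1.
  by rewrite (e_eq1 e1) in nz.
by rewrite e1 group1.
Qed.

Lemma col_pr_det i j i' j' k (l : xline) : ~~ ((i == 0%R) && (j == 0%R)) ->
    e i j 0%R \in line_stab l ->
  collinear ((e i' j' k).1 y0) (pr l) = ((i * j' - j * i')%R == 0%R).
Proof.
move=> nz Al; apply/(col_pr _ (eK _ _ _))/eqP => [[s [c [Ss Ac eq_e]]] | det0].
  have S0 : e 0%R 0%R k \in symmetry_group by rewrite eS !eqxx.
  rewrite e_split in eq_e.
  have E0 : e i' j' 0%R \in E by rewrite eE.
  have [_ eq_c] := decomp_inj sym_normal line_stab_sub order_gt1 card_xline
    stab_tangency S0 Ss E0 (mem_transv Ac) eq_e.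
  by apply: line_stab_det Al _; rewrite eq_c.
exists (e 0%R 0%R k), (e i' j' 0%R); split; first by rewrite eS !eqxx.
  exact: dir_eq nz Al det0.
exact: e_split.
Qed.

Lemma act_pr_eq g h (l : xline) : g \in K -> h \in K ->
  collinear ((g * h^-1).1 y0) (pr l) -> g.1 (pr l) = h.1 (pr l).
Proof.
move=> Kg Kh /fix_pr; rewrite groupM ?groupV // => /(_ isT).
by rewrite actMp => /(congr1 h.1); rewrite actVKp.
Qed.

Local Open Scope ring_scope.

Lemma col_ee i j k i' j' k' : collinear ((e i j k).1 y0) ((e i' j' k').1 y0) =
  (k' - k + (i * j' - j * i') == 0).
Proof.
rewrite -(K_col _ _ (groupVr (eK i' j' k'))) actVp -actMp col_y0 ?groupM ?groupV //.
rewrite eV eM eE -oppr_eq0; congr (_ == _); ring.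
Qed.

Lemma col_epr i j k i' j' (l : xline) d d' : ~~ ((d == 0) && (d' == 0)) ->
    e d d' 0 \in line_stab l ->
  collinear ((e i j k).1 y0) ((e i' j' 0).1 (pr l)) =
  (i * d' - j * d == i' * d' - j' * d).
Proof.
move=> nz Al; rewrite -(K_col _ _ (groupVr (eK i' j' 0))) actVp -actMp eV eM.
rewrite (col_pr_det _ _ _ nz Al) -[RHS]subr_eq0 -oppr_eq0; congr (_ == _); ring.
Qed.

Let c (u : 'rV[F]_4) k : F := u 0 (inord k).

(** The vector (1, k, i, j) is the image of [y0] under e i j k, and (0, 1, 0, 0) is x. The image of
    [pr l] under e i j 0 depends on i d' - j d alone, where (d, d') is the direction of l;
    orthogonality to (0, v1, d, d') requires this to be - v1, and the inner conditional picks one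
    such pair i, j. *)
Definition psi (u : 'rV[F]_4) : point G :=
  if c u 0 != 0 then (e (c u 2 / c u 0) (c u 3 / c u 0) (c u 1 / c u 0)).1 y0
  else if (c u 2 == 0) && (c u 3 == 0) then x
  else (if c u 3 != 0 then e (- (c u 1 / c u 3)) 0 0 else e 0 (c u 1 / c u 2) 0).1
         (pr (dir (c u 2) (c u 3))).

Lemma psi_infinite u : c u 0 = 0 -> ~~ ((c u 2 == 0) && (c u 3 == 0)) ->
  exists i j, psi u = (e i j 0).1 (pr (dir (c u 2) (c u 3))) /\
    i * c u 3 - j * c u 2 = - c u 1.
Proof.
move=> u0 nz; rewrite /psi u0 eqxx /= (negPf nz).
have [u3 | nz3] := eqVneq (c u 3) 0; last first.
  by exists (- (c u 1 / c u 3)), 0; split=> //; rewrite mul0r subr0 mulNr divfK.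
exists 0, (c u 1 / c u 2); split=> //.
have nz2 : c u 2 != 0 by move: nz; rewrite u3 eqxx andbT.
by rewrite mul0r sub0r divfK.
Qed.

Lemma sympc u v : symp u v =
  c u 0 * c v 1 - c u 1 * c v 0 + c u 2 * c v 3 - c u 3 * c v 2.
Proof. by []. Qed.

Lemma psi_center u : c u 0 = 0 -> c u 2 = 0 -> c u 3 = 0 -> psi u = x.
Proof. by move=> u0 u2 u3; rewrite /psi u0 u2 u3 !eqxx. Qed.

Lemma coef_neq0 u : u != 0 -> c u 0 = 0 -> c u 2 = 0 -> c u 3 = 0 -> c u 1 != 0.
Proof.
move=> nzu u0 u2 u3; apply: contra_neq nzu => u1; apply/rowP=> i; rewrite mxE.
rewrite -[i]inord_val; case: i => [[|[|[|[|]]]] //= lt_i];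
  by rewrite -?[LHS]/(c u _) ?u0 ?u1 ?u2 ?u3.
Qed.

Lemma psi_col_center u v : c u 0 = 0 -> c u 2 = 0 -> c u 3 = 0 -> c u 1 != 0 ->
  collinear (psi u) (psi v) = (symp u v == 0).
Proof.
move=> u0 u2 u3 nz1; rewrite psi_center // sympc u0 u2 u3 !mul0r sub0r subr0 addr0.
rewrite oppr_eq0 mulf_eq0 (negPf nz1) /= col_sym.
have [v0 | nz0] := eqVneq (c v 0) 0; last first.
  by rewrite /psi nz0; apply/negbTE/K_noncol.
have [nz | nz] := boolP ((c v 2 == 0) && (c v 3 == 0)).
  by case/andP: nz => /eqP v2 /eqP v3; rewrite psi_center // col_refl.
have [i [j [-> _]]] := psi_infinite v0 nz.
by rewrite -(fix_center (eK i j 0)) K_col // pr_colx.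
Qed.

Lemma psi_col_affine u v : c u 0 != 0 -> v != 0 ->
  collinear (psi u) (psi v) = (symp u v == 0).
Proof.
move=> nz0 nzv; rewrite sympc.
have [v0 | nzv0] := eqVneq (c v 0) 0; last first.
  rewrite /psi nz0 nzv0 col_ee.
  set lhs := (X in (X == 0) = _); set rhs := (X in _ = (X == 0)).
  have -> : rhs = c u 0 * c v 0 * lhs by rewrite /lhs /rhs; field; rewrite nz0 nzv0.
  by rewrite !mulf_eq0 (negPf nz0) (negPf nzv0).
have [nz | nz] := boolP ((c v 2 == 0) && (c v 3 == 0)).
  case/andP: nz => /eqP v2 /eqP v3; have nz1 := coef_neq0 nzv v0 v2 v3.
  by rewrite col_sym psi_col_center // symp_eq0C sympc.
have [i [j [-> det_ij]]] := psi_infinite v0 nz.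
rewrite {1}/psi nz0 (col_epr _ _ _ _ _ nz (dirP _ _)) det_ij.
rewrite v0 mulr0 subr0 -subr_eq0 opprK.
set lhs := (X in (X == 0) = _); set rhs := (X in _ = (X == 0)).
have -> : rhs = c u 0 * lhs by rewrite /lhs /rhs; field; rewrite nz0.
by rewrite mulf_eq0 (negPf nz0).
Qed.

Lemma psi_col u v : u != 0 -> v != 0 -> collinear (psi u) (psi v) = (symp u v == 0).
Proof.
move=> nzu nzv; have [u0 | nz0] := eqVneq (c u 0) 0; last exact: psi_col_affine.
have [v0 | nzv0] := eqVneq (c v 0) 0; last first.
  by rewrite col_sym symp_eq0C psi_col_affine.
have [nz | nz] := boolP ((c u 2 == 0) && (c u 3 == 0)).
  case/andP: nz => /eqP u2 /eqP u3.
  by apply: psi_col_center => //; apply: coef_neq0.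
have [nz' | nz'] := boolP ((c v 2 == 0) && (c v 3 == 0)).
  case/andP: nz' => /eqP v2 /eqP v3; rewrite col_sym symp_eq0C.
  by apply: psi_col_center => //; apply: coef_neq0.
have [i [j [-> _]]] := psi_infinite u0 nz.
have [i' [j' [-> _]]] := psi_infinite v0 nz'.
rewrite col_pr_pr // sympc u0 v0 mul0r mulr0 subrr add0r.
apply/eqP/eqP=> [eq_dir | det0].
  by apply: line_stab_det (dirP _ _) _; rewrite eq_dir; apply: dirP.
have Al := dir_eq nz (dirP _ _) det0; apply/eqP/negPn/negP=> neq_l.
by have /e_eq1 := A_TI stab_tangency neq_l Al (dirP _ _); rewrite (negPf nz').
Qed.

Lemma row_of (a0 a1 a2 a3 : F) : exists u : 'rV[F]_4,
  [/\ c u 0 = a0, c u 1 = a1, c u 2 = a2 & c u 3 = a3].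
Proof.
by exists (\row_j nth 0 [:: a0; a1; a2; a3] j); split; rewrite /c mxE inordK.
Qed.

Lemma psi_onto z : exists2 u, u != 0 & psi u = z.
Proof.
have nz u k : c u k != 0 -> u != 0 by apply: contra_neq => ->; rewrite /c mxE.
have [-> | [g Kg ->] | [l [g [Kg ->]]]] := point_cases z.
- have [u [u0 u1 u2 u3]] := row_of 0 1 0 0.
  by exists u; [apply: (nz u 1); rewrite u1 oner_eq0 | rewrite psi_center].
- have [i [j [k ->]]] := e_onto Kg; have [u [u0 u1 u2 u3]] := row_of 1 k i j.
  exists u; first by apply: (nz u 0); rewrite u0 oner_eq0.
  by rewrite /psi u0 u1 u2 u3 oner_eq0 !divr1.
have [i [j [k def_g]]] := e_onto Kg.
(* A nontrivial element of the stabiliser supplies the direction (d, d') of l. *)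
have /trivgPn[h Ah nth] : line_stab l :!=: 1%g by rewrite -cardG_gt1 card_line_stab order_gt1.
have [d [d' [k' def_h]]] := e_onto (subsetP (line_stab_sub l) h Ah).
have k'0 : k' = 0 by apply/eqP; rewrite -(eE d d') -def_h (mem_transv Ah).
rewrite {k'}k'0 in def_h; rewrite def_h in Ah nth.
have nzd : ~~ ((d == 0) && (d' == 0)).
  by apply: contra nth => /andP[/eqP-> /eqP->]; rewrite e0.
have def_l : dir d d' = l.
  by apply/eqP/negPn/negP=> /(A_TI stab_tangency) /(_ (dirP _ _) Ah)/eqP; rewrite (negPf nth).
have [u [u0 u1 u2 u3]] := row_of 0 (- (i * d' - j * d)) d d'.
have nzu : ~~ ((c u 2 == 0) && (c u 3 == 0)) by rewrite u2 u3.
exists u.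
  by move: nzu; rewrite negb_and => /orP[]; apply: nz.
have [i' [j' [->]]] := psi_infinite u0 nzu; rewrite u1 u2 u3 opprK def_l => det_eq.
apply: act_pr_eq; rewrite // def_g eV eM (col_pr_det _ _ _ nzd Ah).
rewrite (_ : _ - _ = (i * d' - j * d) - (i' * d' - j' * d)); last by ring.
by rewrite det_eq subrr.
Qed.

End Coordinatisation.

Lemma coordinatisation : cyclic symmetry_group ->
  exists f : 'rV['F_t]_4 -> point G,
    (forall u v, u != 0%R -> v != 0%R -> collinear (f u) (f v) = (symp u v == 0%R)) /\
    (forall z, exists2 u, u != 0%R & f u = z).
Proof.
move=> cycS.
have [e [eK e_onto eM eE eS]] := heisenberg_coordinates sym_normal cycS line_stab_sub
  order_gt1 card_sym card_line_stab card_K card_xline stab_tangency stab_triangle.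
exists (psi eE); split; first exact: (@psi_col e eK eM eE eS).
exact: (psi_onto eK e_onto eM eE eS).
Qed.

End Skew.
End Quadrangle.

(** * The symplectic quadrangle *)

Section IsomorphismCriterion.

Local Open Scope ring_scope.

Variables (G : geometry) (t : nat) (F : finFieldType).
Hypothesis GQ : thick_GQ G.
Hypothesis ord_t : has_order G t t.
Variable psi : 'rV[F]_4 -> point G.
Hypothesis psi_col : forall u v, u != 0 -> v != 0 ->
  collinear (psi u) (psi v) = (symp u v == 0).
Hypothesis psi_onto : forall y, exists2 u, u != 0 & psi u = y.

Implicit Types (y z w : point G) (l m : line G) (u v : 'rV[F]_4).

(** Otherwise a point w != y on a second line through y would be collinear with z and close a
    triangle. *)
Lemma perp_inj y z : (forall w, collinear y w = collinear z w) -> y = z.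
Proof.
move=> eq_perp; apply/eqP/negPn/negP=> neq_yz.
have /colP[l yl zl] : collinear y z by rewrite eq_perp (col_refl ord_t).
have [m ym neq_ml] := exists_line GQ ord_t y l.
have [w wm neq_wy] := exists_point GQ ord_t m y.
have /colP[n zn wn] : collinear z w by rewrite -eq_perp; apply/colP; exists m.
case/eqP: neq_ml; apply: (line_uniq GQ neq_yz) => //.
have [<- // | neq_wz] := eqVneq w z.
by apply: (triangle_line GQ _ neq_wz neq_yz ym wm wn zn yl zl); rewrite eq_sym.
Qed.

Definition coord y : 'rV[F]_4 := odflt 0 [pick u | (u != 0) && (psi u == y)].

Lemma coordP y : coord y != 0 /\ psi (coord y) = y.
Proof.
rewrite /coord; case: pickP => [u /andP[nzu /eqP] | no_u] //=.
by have [u nzu psiu] := psi_onto y; have := no_u u; rewrite nzu psiu eqxx.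
Qed.

Lemma coord_neq0 y : coord y != 0. Proof. by case: (coordP y). Qed.
Lemma psi_coord y : psi (coord y) = y. Proof. by case: (coordP y). Qed.

Lemma coord_col y z : collinear y z = (symp (coord y) (coord z) == 0).
Proof. by rewrite -psi_col ?coord_neq0 // !psi_coord. Qed.

Lemma psi_eq u v : u != 0 -> v != 0 -> (psi u = psi v <-> <[u]>%VS = <[v]>%VS).
Proof.
move=> nzu nzv; split=> [eq_psi | eq_span].
  apply: symp_perp_line => // w; have [-> | nzw] := eqVneq w 0.
    by rewrite !symp0.
  by rewrite -!psi_col // eq_psi.
apply: perp_inj => w; have [w' nzw' <-] := psi_onto w; rewrite !psi_col //.
have spanE a b : a != 0 -> a \in <[b]>%VS -> symp b w' == 0 -> symp a w' == 0.
  move=> nza /vlineP[c ->] /eqP b0.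
  by rewrite symp_eq0C sympZ sympC b0 oppr0 mulr0.
apply/idP/idP; apply: spanE => //; last by rewrite -eq_span memv_line.
by rewrite eq_span memv_line.
Qed.

Lemma coord_span u y : u != 0 -> psi u = y -> <[coord y]>%VS = <[u]>%VS.
Proof. by move=> nzu psiu; apply/psi_eq; rewrite ?coord_neq0 // psi_coord. Qed.

Lemma point_dim y : \dim <[coord y]>%VS == 1%N.
Proof. by rewrite dim_vline coord_neq0. Qed.

Definition to_point y : W_point F :=
  exist (fun U : {vspace 'rV[F]_4} => \dim U == 1%N) <[coord y]>%VS (point_dim y).

Lemma coord_span_inj y z : <[coord y]>%VS = <[coord z]>%VS -> y = z.
Proof. by move/psi_eq; rewrite !psi_coord; apply; apply: coord_neq0. Qed.

Lemma to_point_bij : bijective to_point.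
Proof.
exists (fun U : W_point F => psi (vpick (val U))) => [y | U].
  rewrite -[RHS]psi_coord; apply/psi_eq; rewrite ?coord_neq0 ?vpick0 //.
    by rewrite -dimv_eq0 (eqP (point_dim y)).
  apply/eqP; rewrite eqEdim -memvE memv_pick !dim_vline coord_neq0 vpick0.
  by rewrite -dimv_eq0 (eqP (point_dim y)).
have nzU : vpick (val U) != 0 by rewrite vpick0 -dimv_eq0 (eqP (valP U)).
apply: val_inj => /=; rewrite (coord_span nzU) //.
by apply/eqP; rewrite eqEdim -memvE memv_pick dim_vline nzU (eqP (valP U)).
Qed.

Definition line_points l : point G * point G :=
  odflt (psi 0, psi 0) [pick v | [&& v.1 != v.2, inc v.1 l & inc v.2 l]].

Lemma line_pointsP l : [/\ (line_points l).1 != (line_points l).2,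
  inc (line_points l).1 l & inc (line_points l).2 l].
Proof.
rewrite /line_points; case: pickP => [v /and3P[] | no_v] //=.
have [y yl _] := exists_point GQ ord_t l (psi 0).
have [z zl neq_zy] := exists_point GQ ord_t l y.
by have := no_v (z, y); rewrite neq_zy yl zl.
Qed.

Definition line_span l : {vspace 'rV[F]_4} :=
  (<[coord (line_points l).1]> + <[coord (line_points l).2]>)%VS.

Lemma dim_span2 u v : u != 0 -> v != 0 -> <[u]>%VS != <[v]>%VS ->
  \dim (<[u]> + <[v]>)%VS = 2%N.
Proof.
move=> nzu nzv neq_uv; rewrite dimv_disjoint_sum ?dim_vline ?nzu ?nzv //.
apply/eqP; rewrite -dimv_eq0; apply: contraNT neq_uv => cap.
have capu : (<[u]> :&: <[v]>)%VS = <[u]>%VS.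
  by apply/eqP; rewrite eqEdim capvSl dim_vline nzu lt0n.
have capv : (<[u]> :&: <[v]>)%VS = <[v]>%VS.
  by apply/eqP; rewrite eqEdim capvSr dim_vline nzv lt0n.
by rewrite -capu {1}capv.
Qed.

Lemma mem_plane u v (w : 'rV[F]_4) : \dim (<[u]> + <[v]>)%VS = 2%N -> symp u v = 0 ->
  (w \in (<[u]> + <[v]>)%VS) = (symp w u == 0) && (symp w v == 0).
Proof.
move=> dim2 uv; apply/idP/andP=> [| [/eqP wu /eqP wv]]; last exact: symp_perp_plane.
case/memv_addP=> _ /vlineP[a ->] [_ /vlineP[b ->] ->].
rewrite !(symp_eq0C (_ + _)) !sympD !sympZ !sympp (sympC v u) uv oppr0.
by rewrite !mulr0 !addr0 eqxx.
Qed.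

Lemma line_span_dim l : \dim (line_span l) = 2%N.
Proof.
have [neq _ _] := line_pointsP l; apply: dim_span2; rewrite ?coord_neq0 //.
by apply: contra_neq neq; apply: coord_span_inj.
Qed.

(** The span is its own perp, so membership says that y is collinear with two points of l; without
    triangles, y is then on l. *)
Lemma line_spanE l y : (coord y \in line_span l) = inc y l.
Proof.
have [neq l1 l2] := line_pointsP l; rewrite /line_span mem_plane; last 2 first.
- exact: line_span_dim.
- by apply/eqP; rewrite -coord_col; apply/colP; exists l.
rewrite -!coord_col; apply/andP/idP=> [[/colP[m ym m1] /colP[n yn n2]] | yl].
  have [-> // | neq1] := eqVneq y (line_points l).1.
  have [-> // | neq2] := eqVneq y (line_points l).2.
  by apply: (triangle_line GQ neq _ _ l1 l2 n2 yn m1 ym); rewrite eq_sym.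
by split; apply/colP; exists l.
Qed.

Lemma line_span_isotropic l : totally_isotropic (line_span l).
Proof.
have [neq l1 l2] := line_pointsP l.
apply/forallP=> u; apply/forallP=> v; apply/implyP=> uU; apply/implyP=> vU.
move: uU vU; rewrite /line_span !mem_plane; try exact: line_span_dim; try
  by apply/eqP; rewrite -coord_col; apply/colP; exists l.
case/andP=> u1 u2 vU.
have : v \in line_span l.
  rewrite mem_plane ?line_span_dim //.
  by apply/eqP; rewrite -coord_col; apply/colP; exists l.
case/memv_addP=> _ /vlineP[a ->] [_ /vlineP[b ->] ->].
by rewrite sympD !sympZ (eqP u1) (eqP u2) !mulr0 addr0.
Qed.

Lemma line_dim_isotropic l : (\dim (line_span l) == 2%N) && totally_isotropic (line_span l).
Proof. by rewrite line_span_dim line_span_isotropic. Qed.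

Definition to_line l : W_line F :=
  exist (fun U : {vspace 'rV[F]_4} => (\dim U == 2%N) && totally_isotropic U)
    (line_span l) (line_dim_isotropic l).

Lemma to_line_inj : injective to_line.
Proof.
move=> l m /(congr1 val) /= eq_span; have [neq l1 l2] := line_pointsP l.
by apply: (line_uniq GQ neq l1 l2); rewrite -line_spanE -eq_span line_spanE.
Qed.

(** A basis of U gives two collinear points. Every point of the line joining them has its vector in
    the perp of U, which is U. *)
Lemma to_line_onto (U : W_line F) : exists l, to_line l = U.
Proof.
case: U => U dimU; have /andP[/eqP dim2 /forallP iso] := dimU.
pose u := vpick U; have Uu : u \in U := memv_pick U.
have nzu : u != 0 by rewrite vpick0 -dimv_eq0 dim2.
have [v Uv v_u] : exists2 v, v \in U & v \notin <[u]>%VS.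
  by apply/subvPn; apply: contraL (leqnn 2) => /dimvS; rewrite dim2 dim_vline nzu.
have nzv : v != 0 by apply: contraNneq v_u => ->; apply: mem0v.
have neq_uv : <[u]>%VS != <[v]>%VS by apply: contraNneq v_u => ->; apply: memv_line.
have uv : symp u v = 0.
  by apply/eqP; move/forallP: (iso u) => /(_ v); rewrite Uu Uv.
have dim_uv := dim_span2 nzu nzv neq_uv.
have defU : U = (<[u]> + <[v]>)%VS.
  by apply/esym/eqP; rewrite eqEdim subv_add -!memvE Uu Uv dim_uv dim2.
have /colP[l ul vl] : collinear (psi u) (psi v) by rewrite psi_col // uv.
exists l; apply: val_inj => /=; apply/eqP; rewrite eqEdim line_span_dim dim2 andbT.
have memU y : inc y l -> coord y \in U.
  move=> yl; rewrite defU mem_plane // -!psi_col ?coord_neq0 // psi_coord.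
  by apply/andP; split; apply/colP; exists l.
by have [_ l1 l2] := line_pointsP l; rewrite subv_add -!memvE !memU.
Qed.

Lemma to_line_bij : bijective to_line.
Proof.
have /fin_all_exists[inv_line inv_lineK] := to_line_onto.
by exists inv_line => // l; apply: to_line_inj; rewrite inv_lineK.
Qed.

Lemma isomorphic_W : isomorphic G (W F).
Proof.
exists to_point, to_line; split=> [||y l]; first exact: to_point_bij.
  exact: to_line_bij.
by rewrite /= -memvE line_spanE.
Qed.

End IsomorphismCriterion.

Theorem theorem6p2 (G : geometry) (t : nat) (x : point G)
    (K : {group permT G}) :
  STGQ x K ->
  has_order G t t ->
  cyclic (symmetries x) ->
  prime t /\ isomorphic G (W 'F_t).
Proof.
move=> [[GQ autK fixK sharpK] centx sSK] ord_t cycS.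
have cycS' : cyclic (symmetry_group x) by [].
have [y0] : exists y0, y0 \in ~: perp x.
  by apply/card_gt0P; rewrite (card_noncollinear GQ ord_t) expn_gt0 (order_gt0 GQ ord_t).
rewrite !inE => y0x; have [pm pmP] := exists_proj GQ y0x.
split; first exact: (order_prime GQ ord_t autK fixK sharpK centx sSK y0x pmP cycS').
have [f [f_col f_onto]] := coordinatisation GQ ord_t autK fixK sharpK centx sSK y0x pmP cycS'.
exact: (isomorphic_W GQ ord_t f_col f_onto).
Qed.
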